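(* Let $N\ge1$, let $\lambda=(\lambda_1,\dots,\lambda_N)$ be a generalized partition, and let $x=(x_1,\dots,x_N)$, $x^{\pm}=(x_1^{\pm1},\dots,x_N^{\pm1})$. Define, for a parameter $\alpha$, $$s^{BD}_\lambda(x;\alpha)=\langle0|\Gamma_+(x^{\pm})\Gamma_+^{-1}(\alpha)|\lambda^{so}\rangle,\quad s^{BC}_\lambda(x;\alpha)=\langle0|\Gamma_+(x^{\pm})\Gamma_+(\alpha)|\lambda^{so}\rangle,\quad s^{CD}_\lambda(x;\alpha)=\langle0|\Gamma_+(x^{\pm})\widetilde\Gamma_+(\alpha)|\lambda^{sp}\rangle.$$ Then these polynomials interpolate between the characters of types $B$, $C$, $D$: $$s^{BD}_\lambda(x;0)=so_\lambda(x^{\pm}),\quad s^{BD}_\lambda(x;1)=o_\lambda(x^{\pm}),$$ $$s^{BC}_\lambda(x;0)=so_\lambda(x^{\pm}),\quad s^{BC}_\lambda(x;-1)=sp_\lambda(x^{\pm}),$$ $$s^{CD}_\lambda(x;0)=sp_\lambda(x^{\pm}),\quad s^{CD}_\lambda(x;1)=o_\lambda(x^{\pm}).$$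
   Context: A generalized partition is a weakly decreasing finite sequence of nonnegative integers (zeros allowed). Characters: in $N$ variables let $h_n=h_n(x^{\pm})$ be defined by $\prod_{i=1}^N\frac{1}{(1-x_iz)(1-x_i^{-1}z)}=\sum_{n}h_nz^n$ ($h_n=0$ for $n<0$). The odd orthogonal, symplectic and (even) orthogonal characters are given by their Jacobi–Trudi determinants ($1\le i,j\le N$): $so_\lambda(x^{\pm})=\det(h_{\lambda_i-i+j}+h_{\lambda_i-i-j+1})$, $sp_\lambda(x^{\pm})=\det(h_{\lambda_i-i+j}+\delta_{j>1}h_{\lambda_i-i-j+2})$, $o_\lambda(x^{\pm})=\det(h_{\lambda_i-i+j}-h_{\lambda_i-i-j})$, where $\delta_{j>1}$ is $1$ if $j>1$ and $0$ otherwise. Heisenberg algebra: generators $a_n$ ($n\in\mathbb Z\setminus\{0\}$) with $[a_m,a_n]=m\delta_{m,-n}$. The Fock space $\mathcal M$ is generated by the vacuum $|0\rangle$ with $a_n|0\rangle=0$ for $n>0$ (so $\mathcal M\cong\mathbb C[a_{-1},a_{-2},\dots]$), and $\langle 0|$ is the dual vacuum, a linear functional on $\mathcal M$ with $\langle 0|a_{-n}=0$ for $n>0$ and $\langle 0|1|0\rangle=1$. Vertex operators: $$U(z)=(1+z)\exp\Big(\sum_{n\ge1}\tfrac{a_{-n}}{n}z^n\Big)\exp\Big(-\sum_{n\ge1}\tfrac{a_n}{n}(z^n+z^{-n})\Big)=\sum_{n\in\mathbb Z}U_nz^{-n},$$ $$Y(z)=\exp\Big(\sum_{n\ge1}\tfrac{a_{-n}}{n}z^n\Big)\exp\Big(-\sum_{n\ge1}\tfrac{a_n}{n}(z^n+z^{-n})\Big)=\sum_{n\in\mathbb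 Z}Y_nz^{-n},$$ and $|\lambda^{so}\rangle=U_{-\lambda_1}\cdots U_{-\lambda_N}|0\rangle$, $|\lambda^{sp}\rangle=Y_{-\lambda_1}\cdots Y_{-\lambda_N}|0\rangle$. Half vertex operators: $\Gamma_+(z)=\exp\big(\sum_{n\ge1}\frac{a_n}{n}z^n\big)$, $\Gamma_+(x^{\pm})=\prod_{i=1}^N\Gamma_+(x_i)\Gamma_+(x_i^{-1})$, and $\widetilde\Gamma_+(z)=\exp\big(-\sum_{n\ge1}\frac{a_{2n}}{n}z^n\big)$. *)

(* Defs.v *)
From HB Require Import structures.
From mathcomp Require Import all_boot all_order all_algebra.
From mathcomp Require Import finmap boolp classical_sets functions fsbigop.
From mathcomp Require Import monalg.

Set Implicit Arguments.
Unset Strict Implicit.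
Unset Printing Implicit Defensive.

Import Order.TTheory GRing.Theory Num.Theory.
Local Open Scope ring_scope.

(* All infinite sums of operators below are locally finite: evaluated at a
   fixed vector they have finitely many nonzero terms.  They are written as
   finitely supported sums [\sum_(k \in setT) _]. *)

Section OperatorSeries.
Variables (F : fieldType) (V : lmodType F).

(* exp(A) = sum_m A^m / m! *)
Definition opexp (A : V -> V) : V -> V := fun v =>
  \sum_(m \in [set: nat]) (m`!%:R : F)^-1 *: iter m A v.

(* Operator-valued formal series in z^{+-1}: [A k] is the coefficient of z^k. *)
Definition opseries := int -> V -> V.

Definition ops1 : opseries := fun k v => if k == 0 then v else 0.

Definition opsM (A B : opseries) : opseries := fun n v =>
  \sum_(k \in [set: int]) A (n - k) (B k v).

Definition opsX (A : opseries) (m : nat) : opseries := iter m (opsM A) ops1.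

Definition opsexp (A : opseries) : opseries := fun n v =>
  \sum_(m \in [set: nat]) (m`!%:R : F)^-1 *: opsX A m n v.

End OperatorSeries.

(* Partial derivative of a polynomial with respect to the variable of index n. *)
HB.lock Definition fockD (F : fieldType) (n : nat) (v : {malg F[{cmonom nat}]})
    : {malg F[{cmonom nat}]} :=
  \sum_(m <- msupp v) mkmalgU (divcm m (ucm n)) (mcoeff m v *+ m n).

Section Fock.
Variable F : fieldType.

(* The Fock space F[a_{-1}, a_{-2}, ...]: polynomials in variables indexed by
   nat, the variable of index n standing for a_{-(n+1)}. *)
Local Notation fock := {malg F[{cmonom nat}]}.

Definition vac : fock := 1.

(* <0| reads off the coefficient of |0>. *)
Definition vacdual (v : fock) : F := mcoeff (mone : {cmonom nat}) v.

Definition fockX (n : nat) : fock := mkmalgU (ucm n) 1.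

(* a_{-n} is multiplication by the variable a_{-n} and a_n is n d/da_{-n}, for
   n > 0 (recall that Negz n = -(n+1)).  There is no generator a_0; the value
   at 0 is a placeholder that is never used. *)
Definition heis (k : int) (v : fock) : fock :=
  match k with
  | Posz 0 => 0
  | Posz n.+1 => n.+1%:R *: fockD n v
  | Negz n => fockX n * v
  end.

Lemma fockDE n (v : fock) (m : {cmonom nat}) :
  mcoeff m (fockD n v) = mcoeff (mmul m (ucm n)) v *+ (m n).+1.
Proof.
rewrite unlock raddf_sum /=.
under eq_bigr do rewrite mcoeffU.
have mK : divcm (mmul m (ucm n)) (ucm n) = m.
  by apply/eqP/cmP => i; rewrite divcmE cmM addnK.
have [mv | mv] := boolP (mmul m (ucm n) \in msupp v).
  rewrite (big_fsetD1 _ mv) /= mK eqxx mulr1n cmM cmU eqxx addn1.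
  rewrite big_seq big1 ?addr0 // => k; rewrite in_fsetD1 => /andP[k_neq _].
  have [km | _] := eqVneq (divcm k (ucm n)) m; last by rewrite mulr0n.
  suff -> : k n = 0%N by rewrite mulr0n mul0rn.
  apply/eqP; apply: contraNT k_neq; rewrite -lt0n => kn.
  apply/cmP => i; rewrite -km cmM divcmE subnK // cmU.
  by have [<-|] := eqVneq n i.
rewrite (mcoeff_outdom mv) mul0rn big_seq big1 // => k kv.
have [km | _] := eqVneq (divcm k (ucm n)) m; last by rewrite mulr0n.
suff -> : k n = 0%N by rewrite mulr0n mul0rn.
apply/eqP; apply: contraNT mv; rewrite -lt0n => kn.
suff -> : mmul m (ucm n) = k by [].
apply/eqP/cmP => i; rewrite -km cmM divcmE subnK // cmU.
by have [<-|] := eqVneq n i.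
Qed.

Lemma fockXE n (v : fock) (m : {cmonom nat}) :
  mcoeff m (fockX n * v) =
  if (0 < m n)%N then mcoeff (divcm m (ucm n)) v else 0.
Proof.
rewrite /fockX [v]monalgE mulr_sumr !raddf_sum /=.
under eq_bigr do rewrite malgM_def fgmulUU mul1r mcoeffU.
case: ifPn => [mn | mn].
  apply: eq_bigr => k _; rewrite mcoeffU; congr (_ *+ nat_of_bool _).
  apply/eqP/eqP => [<- | ->]; apply/eqP/cmP => i.
    by rewrite divcmE cmM addKn.
  rewrite cmM divcmE subnKC // cmU.
  by have [<-|] := eqVneq n i.
rewrite big1 // => k _.
case: eqP => [km |]; last by rewrite mulr0n.
by move: mn; rewrite -km cmM cmU eqxx.
Qed.

Lemma fockD_fockX i j (v : fock) :
  fockD i (fockX j * v) = fockX j * fockD i v + (if i == j then v else 0).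
Proof.
apply/malgP => m; rewrite mcoeffD fockDE !fockXE cmM cmU.
case: (eqVneq i j) => [<- | nij].
  rewrite addn1 /=.
  have -> : divcm (mmul m (ucm i)) (ucm i) = m.
    by apply/eqP/cmP => k; rewrite divcmE cmM addnK.
  case: ifPn => [mi | ]; last by rewrite -eqn0Ngt => /eqP->; rewrite add0r.
  rewrite fockDE divcmE cmU eqxx subn1 prednK // mulrSr; congr (mcoeff _ _ *+ _ + _).
  apply/eqP/cmP => k; rewrite cmM divcmE subnK // cmU.
  by have [<-|] := eqVneq i k.
rewrite addn0 mcoeff0 addr0; case: ifPn => [mj | _]; last by rewrite mul0rn.
rewrite fockDE divcmE cmU eq_sym (negPf nij) subn0.
congr (mcoeff _ _ *+ _); apply/eqP/cmP => k; rewrite !(divcmE, cmM, cmU).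
have [<-|] := eqVneq j k; last by rewrite !subn0.
by rewrite (negPf nij) !addn0.
Qed.

Lemma fockDC i j (v : fock) : fockD i (fockD j v) = fockD j (fockD i v).
Proof.
have [-> // | nij] := eqVneq i j; apply/malgP => m; rewrite !fockDE !cmM !cmU.
have -> : mmul (mmul m (ucm i)) (ucm j) = mmul (mmul m (ucm j)) (ucm i).
  by apply/eqP/cmP => k; rewrite !cmM addnAC.
by rewrite (eq_sym j) (negPf nij) !addn0 -!mulrnA mulnC.
Qed.

Lemma fockDZ i c (v : fock) : fockD i (c *: v) = c *: fockD i v.
Proof.
apply/malgP => m.
by rewrite fockDE [RHS]mcoeffZ [in RHS]fockDE mcoeffZ mulrnAr.
Qed.

(* [a_m, a_n] = m delta_{m,-n} *)
Lemma heis_comm (m n : int) (v : fock) : m != 0 -> n != 0 ->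
  heis m (heis n v) - heis n (heis m v) = if m == - n then m%:~R *: v else 0.
Proof.
case: m => [[|m]|m]; case: n => [[|n]|n] // _ _ /=.
- by rewrite !fockDZ fockDC !scalerA mulrC subrr.
- rewrite fockD_fockX scalerDr scalerAr addrAC subrr add0r.
  rewrite NegzE opprK eqz_nat eqSS.
  by case: eqP => // _; rewrite scaler0.
- rewrite fockD_fockX scalerDr scalerAr opprD addrA subrr sub0r.
  rewrite !NegzE eqr_opp eqz_nat eqSS eq_sym.
  case: eqP => [-> | _]; last by rewrite scaler0 oppr0.
  by rewrite mulrNz -pmulrn scaleNr.
- by apply/eqP; rewrite subr_eq0; apply/eqP; exact: mulrCA.
Qed.

Lemma heis_vac n : heis n.+1%:Z vac = 0.
Proof.
apply/malgP => m /=; rewrite mcoeffZ fockDE mcoeff0 /vac mcoeff1.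
by rewrite cmM_eq1 cm1_eq1 andbF mul0rn mulr0.
Qed.

Lemma vacdual_heis n (v : fock) : vacdual (heis (- n.+1%:Z) v) = 0.
Proof. by rewrite -NegzE /vacdual /= fockXE cm1. Qed.

Lemma vacdual_vac : vacdual vac = 1.
Proof. by rewrite /vacdual mcoeff1 eqxx. Qed.

(* sum_{n>=1} (a_{-n}/n) z^n *)
Definition creation_series : opseries fock := fun k v =>
  if 0 < k then (k%:~R : F)^-1 *: heis (- k) v else 0.

(* - sum_{n>=1} (a_n/n) (z^n + z^{-n}) *)
Definition annihilation_series : opseries fock := fun k v =>
  if k == 0 then 0 else - ((`|k|%:~R : F)^-1 *: heis `|k| v).

Definition Yseries : opseries fock :=
  opsM (opsexp creation_series) (opsexp annihilation_series).

(* U(z) = (1 + z) Y(z) *)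
Definition Useries : opseries fock := fun k v => Yseries k v + Yseries (k - 1) v.

(* Modes are indexed by U(z) = sum_n U_n z^{-n}, and likewise for Y. *)
Definition Umode (n : int) : fock -> fock := Useries (- n).
Definition Ymode (n : int) : fock -> fock := Yseries (- n).

Definition ket_so (lam : seq nat) : fock :=
  foldr (fun (l : nat) v => Umode (- l%:Z) v) vac lam.
Definition ket_sp (lam : seq nat) : fock :=
  foldr (fun (l : nat) v => Ymode (- l%:Z) v) vac lam.

(* The summation index n below is n - 1 in the usual sum over n >= 1. *)
Definition Gamma (z : F) : fock -> fock :=
  opexp (fun v =>
    \sum_(n \in [set: nat]) (z ^+ n.+1 / n.+1%:R) *: heis n.+1%:Z v).

Definition Gamma_inv (z : F) : fock -> fock :=
  'pinv_(fun=> 0) [set: fock] (Gamma z).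

Definition Gamma_tilde (z : F) : fock -> fock :=
  opexp (fun v =>
    - \sum_(n \in [set: nat]) (z ^+ n.+1 / n.+1%:R) *: heis (2 * n.+1)%N%:Z v).

Definition Gamma_pm (N : nat) (x : 'I_N -> F) : fock -> fock :=
  \big[comp/id]_(i < N) (Gamma (x i) \o Gamma (x i)^-1).

Definition sBD N (x : 'I_N -> F) (lam : seq nat) (alpha : F) : F :=
  vacdual (Gamma_pm x (Gamma_inv alpha (ket_so lam))).
Definition sBC N (x : 'I_N -> F) (lam : seq nat) (alpha : F) : F :=
  vacdual (Gamma_pm x (Gamma alpha (ket_so lam))).
Definition sCD N (x : 'I_N -> F) (lam : seq nat) (alpha : F) : F :=
  vacdual (Gamma_pm x (Gamma_tilde alpha (ket_sp lam))).

End Fock.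

Section Characters.
Variable F : fieldType.

(* Formal power series over F as coefficient sequences; [geom c] is the series
   1 / (1 - c z). *)
Definition ps1 (n : nat) : F := (n == 0)%:R.
Definition psM (u v : nat -> F) (n : nat) : F := \sum_(i < n.+1) u i * v (n - i)%N.
Definition geom (c : F) (n : nat) : F := c ^+ n.

Definition hseries N (x : 'I_N -> F) : nat -> F :=
  \big[psM/ps1]_(i < N) psM (geom (x i)) (geom (x i)^-1).

Definition h N (x : 'I_N -> F) (n : int) : F :=
  if n is Posz k then hseries x k else 0.

(* The matrix indices i, j start at 0, hence the successors. *)
Definition so_char N (x : 'I_N -> F) (lam : N.-tuple nat) : F :=
  \det (\matrix_(i < N, j < N)
    (h x ((tnth lam i)%:Z - i.+1%:Z + j.+1%:Z)
     + h x ((tnth lam i)%:Z - i.+1%:Z - j.+1%:Z + 1))).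

Definition sp_char N (x : 'I_N -> F) (lam : N.-tuple nat) : F :=
  \det (\matrix_(i < N, j < N)
    (h x ((tnth lam i)%:Z - i.+1%:Z + j.+1%:Z)
     + (1 < j.+1)%N%:R * h x ((tnth lam i)%:Z - i.+1%:Z - j.+1%:Z + 2))).

Definition o_char N (x : 'I_N -> F) (lam : N.-tuple nat) : F :=
  \det (\matrix_(i < N, j < N)
    (h x ((tnth lam i)%:Z - i.+1%:Z + j.+1%:Z)
     - h x ((tnth lam i)%:Z - i.+1%:Z - j.+1%:Z))).

End Characters.

(* Main.v *)
Require Import Defs.
From HB Require Import structures.
From mathcomp Require Import all_boot all_order all_algebra.
From mathcomp Require Import finmap boolp classical_sets functions fsbigop.
From mathcomp Require Import monalg zify ring.

Set Implicit Arguments.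
Unset Strict Implicit.
Unset Printing Implicit Defensive.

Import Order.TTheory GRing.Theory Num.Theory.
Local Open Scope ring_scope.

(** A vector of Fock space is a polynomial in a_{-1}, a_{-2}, ..., so the
    exponential of a combination sum_n c_n d/da_{-n} of annihilation operators
    is the substitution a_{-n} |-> a_{-n} + c_n.  Hence <0| Gamma_+(x^{+-}) G
    is evaluation of polynomials at a sequence of power sums, while the creation
    half of Y(z) is multiplication by the generating series of the complete
    symmetric functions h_n, which is characterised by Newton's identities.
    The annihilation half of Y(z) replaces h_n by
    h_n - (z + z^-1) h_{n-1} + h_{n-2}.  This turns a symplectic Jacobi-Trudi
    determinant of size N into one of size N + 1 whose new first row is
    (1, z + z^-1, z^2 + z^-2, ...), so by induction |lambda^sp> is the symplectic
    Jacobi-Trudi determinant in the h_n, and |lambda^so> the same determinant in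
    the h_n + h_{n-1}.  The parameter alpha multiplies the generating series of
    the evaluated h_n by a rational factor, and unitriangular column operations
    identify the six resulting determinants. *)

(** * Locally finite sums as ordinary finite sums *)

Section FiniteSums.
Variable V : zmodType.

Lemma fsum_nat (f : nat -> V) (M : nat) :
    (forall k, (M <= k)%N -> f k = 0) ->
  \sum_(k \in [set: nat]) f k = \sum_(k < M) f k.
Proof.
move=> f0; rewrite (fsbigE (index_iota 0 M)) ?iota_uniq //.
  rewrite -[RHS](big_mkord xpredT f); apply: eq_bigl => i.
  by rewrite in_setT.
by move=> k _; rewrite mem_index_iota /= -leqNgt; apply: f0.
Qed.

Lemma fsum_int (f : int -> V) (M : nat) :
    (forall k : int, (M < `|k|)%N -> f k = 0) ->
  \sum_(k \in [set: int]) f k = f 0 + \sum_(i < M) (f i.+1%:Z + f (- i.+1%:Z)).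
Proof.
move=> f0.
pose r : seq int := 0 :: [seq i.+1%:Z | i <- iota 0 M] ++ [seq - i.+1%:Z | i <- iota 0 M].
have r_uniq : uniq r.
  rewrite /r cons_uniq cat_uniq !map_inj_uniq ?iota_uniq; last 2 first.
  - by move=> i j /eqP; rewrite eqr_opp eqz_nat eqSS => /eqP.
  - by move=> i j [].
  rewrite andbT /= mem_cat negb_or -andbA; apply/and3P; split.
  - by apply/mapP => -[].
  - by apply/mapP => -[i _] /eqP; rewrite eq_sym oppr_eq0.
  - by apply/hasPn => _ /mapP[i _ ->]; apply/mapP => -[].
rewrite (fsbigE r) //; last first.
  move=> k _ kr; apply: f0; rewrite ltnNge; apply: contra kr => kM.
  rewrite inE mem_cat; case: k kM => [[|k]|k] kM //=.
    apply/orP; left; apply/mapP; exists k => //; rewrite mem_iota; exact: kM.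
  apply/orP; right; apply/mapP; exists k; rewrite ?NegzE // mem_iota; exact: kM.
rewrite big_mkcond big_cons in_setT big_cat !big_map -!/(index_iota _ _) /=.
have bm (g : nat -> V) : \sum_(j <- iota 0 M) g j = \sum_(j < M) g j.
  by rewrite -(big_mkord xpredT) /index_iota subn0.
by rewrite !bm big_split; congr (_ + (_ + _));
  apply: eq_bigr => i _; rewrite in_setT.
Qed.

(** Indexing the window from -M to M by ordinals lets double Laurent sums be exchanged, and turns
    Laurent polynomials into polynomials after multiplication by z^M. *)
Lemma fsum_int_shift (f : int -> V) (M : nat) :
    (forall k : int, (M < `|k|)%N -> f k = 0) ->
  \sum_(k \in [set: int]) f k = \sum_(i < M.*2.+1) f (i%:Z - M%:Z).
Proof.
move=> f0; pose r : seq int := [seq i%:Z - M%:Z | i <- iota 0 M.*2.+1].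
have r_uniq : uniq r.
  by rewrite map_inj_uniq ?iota_uniq // => i j /addIr[].
rewrite (fsbigE r) //; last first.
  move=> /= k _ kr; apply: f0; rewrite ltnNge; apply: contra kr => kM.
  apply/mapP; exists (absz ((k : int) + M%:Z)); first by rewrite mem_iota; lia.
  by lia.
rewrite big_mkcond big_map -(big_mkord xpredT (fun i => f (i%:Z - M%:Z))).
by rewrite /index_iota subn0; apply: eq_bigr => i _; rewrite in_setT.
Qed.

Lemma fsum_single (T : choiceType) (f : T -> V) (a : T) :
  (forall k, k != a -> f k = 0) -> \sum_(k \in [set: T]) f k = f a.
Proof.
move=> f0; rewrite (fsbigE [:: a]) //.
  by rewrite big_mkcond big_seq1 in_setT.
by move=> k _; rewrite inE => /f0.
Qed.

Lemma fsum_int_translate (f : int -> V) (k : int) :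
  \sum_(n \in [set: int]) f (n - k) = \sum_(n \in [set: int]) f n.
Proof.
apply/esym/(@reindex_fsbigT _ _ _ _ _ (fun n : int => n - k)).
by exists (fun n => n + k) => n; rewrite ?subrK ?addrK.
Qed.

End FiniteSums.

(** * Newton's identities and multiplication by linear factors *)

Definition zext (R : nmodType) (u : nat -> R) (n : int) : R :=
  if n is Posz k then u k else 0.

Section Newton.
Variable R : comNzRingType.
Implicit Types (c d u v : nat -> R).

(* Newton's identities between power sums c_0, c_1, ... (shifted by one) and
   complete symmetric functions u_0, u_1, ... *)
Definition newton c u := u 0 = 1 /\
  forall n, n.+1%:R * u n.+1 = \sum_(i < n.+1) c i * u (n - i)%N.

(** The recursion determines (n+1) u_{n+1} from the earlier terms, and torsion-freeness cancels n+1.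
    This form of the hypothesis fits both Fock space and the base field. *)
Lemma newton_uniq c u v : (forall n (a : R), a *+ n.+1 = 0 -> a = 0) ->
  newton c u -> newton c v -> u =1 v.
Proof.
move=> regR [u0 uS] [v0 vS] n.
elim/ltn_ind: n => -[_|n IH]; first by rewrite u0 v0.
apply/eqP; rewrite -subr_eq0; apply/eqP/(regR n).
rewrite -mulr_natl mulrBr uS vS; apply/eqP; rewrite subr_eq0; apply/eqP.
by apply: eq_bigr => i _; rewrite IH // ltnS leq_subr.
Qed.

Lemma eq_newton c d u v : c =1 d -> u =1 v -> newton c u -> newton d v.
Proof.
move=> cd uv [u0 uS]; split=> [|n]; first by rewrite -uv.
by rewrite -uv uS; apply: eq_bigr => i _; rewrite cd uv.
Qed.

(* The coefficients of (1 - z t) sum_n u_n t^n. *)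
Definition twist (z : R) u (n : nat) : R :=
  u n - z * (if n is n'.+1 then u n' else 0).

Lemma zext_twist z u (n : int) :
  zext (twist z u) n = zext u n - z * zext u (n - 1).
Proof. by case: n => [[|n]|n] //=; rewrite ?subn1 // mulr0 subr0. Qed.

(** Multiplying the generating series by 1 - zt subtracts z/(1 - zt), whose coefficients are the
    z^{i+1}, from its logarithmic derivative. *)
Lemma newton_twist z c u : newton c u ->
  newton (fun i => c i - z ^+ i.+1) (twist z u).
Proof.
move=> [u0 uS]; split=> [|n]; first by rewrite /twist mulr0 subr0.
(* Coefficient form of (z/(1 - zt)) (1 - zt) u = z u. The cutoff in [G] gives 0 at index n + 1,
   where truncated subtraction would give [u 0]. *)
have telescope : \sum_(i < n.+1) z ^+ i.+1 * twist z u (n - i)%N = z * u n.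
  pose G i := if (i <= n)%N then z ^+ i.+1 * u (n - i)%N else 0.
  rewrite (eq_bigr (fun i : 'I_n.+1 => - (G i.+1 - G i))).
    rewrite sumrN -(big_mkord xpredT (fun i => G i.+1 - G i)) telescope_sumr //.
    by rewrite /G ltnn leq0n subn0 expr1 sub0r opprK.
  move=> [i /= i_lt] _; rewrite /G opprB (_ : (i <= n)%N) // mulrBr mulrA -exprSr.
  have [i_lt_n | n_le_i] := ltnP i n; first by rewrite -(subnSK i_lt_n).
  by rewrite (eqP n_le_i) mulr0 !subr0.
(* The difference of the two series is z t u, so this is the coefficient of t^n in z t u'. *)
have shift : \sum_(i < n.+1) c i * (u (n - i)%N - twist z u (n - i)%N) =
    z * (n%:R * u n).
  rewrite big_ord_recr /= subnn /twist mulr0 subr0 subrr mulr0 addr0.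
  case: n {telescope} => [|n]; first by rewrite big_ord0 mul0r mulr0.
  rewrite uS mulr_sumr; apply: eq_bigr => -[i /= i_lt] _.
  by rewrite subSn // opprB addrC subrK mulrCA.
under eq_bigr do rewrite mulrBl.
rewrite sumrB telescope.
under eq_bigr => i _ do rewrite -[twist _ _ _](subKr (u (n - i)%N)) mulrBr.
by rewrite sumrB shift -uS /twist; ring.
Qed.

End Newton.

(** * Complete symmetric functions of the variables and their inverses *)

Section PowerSeries.
Variable F : fieldType.
Implicit Types (c d u v : nat -> F).

Lemma newton_geom (z : F) : newton (fun i => z ^+ i.+1) (geom z).
Proof.
split=> [|n]; first by rewrite /geom expr0.
rewrite (eq_bigr (fun=> z ^+ n.+1)) => [|[i /= i_lt] _].
  by rewrite sumr_const card_ord mulr_natl.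
by rewrite /geom -exprD addSn subnKC.
Qed.

Lemma newton_ps1 : newton (fun=> 0) (@ps1 F).
Proof.
by split=> [//|n]; rewrite /ps1 mulr0 big1 // => i _; rewrite mul0r.
Qed.

(* The series are truncated to polynomials, whose product rule is Newton's
   identity for the sum of the power sums. *)
Lemma newton_psM c d u v :
  newton c u -> newton d v -> newton (fun i => c i + d i) (psM u v).
Proof.
move=> [u0 uS] [v0 vS]; split=> [|n].
  by rewrite /psM big_ord_recl big_ord0 /= u0 v0 mulr1 addr0.
pose T w : {poly F} := \poly_(i < n.+2) w i.
have TE w i : (i <= n.+1)%N -> (T w)`_i = w i by move=> i_le; rewrite coef_poly ltnS i_le.
have TM w w' i : (i <= n.+1)%N -> (T w * T w')`_i = \sum_(j < i.+1) w j * w' (i - j)%N.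
  move=> i_le; rewrite coefM; apply: eq_bigr => -[j /= j_lt] _.
  by rewrite !TE //; lia.
have Td (e w : nat -> F) :
    (forall m, m.+1%:R * w m.+1 = \sum_(i < m.+1) e i * w (m - i)%N) ->
    forall i, (i <= n)%N -> (T w)^`()`_i = (T e * T w)`_i.
  move=> wS i i_le; rewrite coef_deriv TE // TM; last by lia.
  by rewrite -mulr_natl wS.
rewrite mulr_natl -[psM u v n.+1]/(\sum_(j < n.+2) u j * v (n.+1 - j)%N) -TM //.
rewrite -coef_deriv derivM coefD.
have -> : ((T u)^`() * T v)`_n = (T c * (T u * T v))`_n.
  rewrite mulrA !coefM; apply: eq_bigr => -[i /= i_lt] _; congr (_ * _).
  exact: Td.
have -> : (T u * (T v)^`())`_n = (T d * (T u * T v))`_n.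
  rewrite mulrCA !coefM; apply: eq_bigr => -[i /= i_lt] _; congr (_ * _).
  by apply: Td => //; lia.
rewrite -coefD -mulrDl coefM; apply: eq_bigr => -[i /= i_lt] _.
by rewrite coefD !TE ?TM //; lia.
Qed.

Definition psum N (x : 'I_N -> F) (k : nat) : F :=
  \sum_(i < N) (x i ^+ k.+1 + (x i)^-1 ^+ k.+1).

Lemma newton_hseries N (x : 'I_N -> F) : newton (psum x) (hseries x).
Proof.
elim: N x => [|N IH] x.
  rewrite /hseries big_ord0; apply: eq_newton newton_ps1 => // i.
  by rewrite /psum big_ord0.
rewrite /hseries big_ord_recl.
apply: eq_newton (newton_psM (newton_psM (newton_geom _) (newton_geom _)) (IH _)) => //.
by move=> i; rewrite /psum [RHS]big_ord_recl.
Qed.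

End PowerSeries.

(** * Column operations on symplectic Jacobi-Trudi determinants *)

Section ColumnOperations.
Variable R : comNzRingType.

Lemma det_column_operation n (f e : nat -> nat -> R) :
  \det (\matrix_(i < n, j < n) (f i j + \sum_(k < j) f i k * e k j)) =
  \det (\matrix_(i < n, j < n) f i j).
Proof.
(* The column operations are right multiplication by the transpose of [T]; [T] itself is lower
   unitriangular, the shape that [det_trig] expects. *)
pose T := \matrix_(j < n, k < n)
  (if (k < j)%N then e k j else (k == j)%:R).
have detT : \det T = 1.
  rewrite det_trig; last first.
    apply/is_trig_mxP => i j ij; rewrite mxE ltnNge ltnW //.
    by rewrite -val_eqE /= gtn_eqF.
  by rewrite big1 // => i _; rewrite mxE ltnn eqxx.
rewrite -[RHS]mulr1 -detT -(det_tr T) -det_mulmx; congr (\det _).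
apply/matrixP => i j; rewrite !mxE.
rewrite (eq_bigr (fun k : 'I_n => f i k * (if (k < j)%N then e k j else (k == j)%:R))).
  rewrite (bigID (fun k : 'I_n => (k < j)%N)) /= addrC; congr (_ + _).
    rewrite (bigD1 j) ?ltnn //= eqxx mulr1 big1 ?addr0 // => k /andP[].
    by move=> /negbTE -> /negbTE ->; rewrite mulr0.
  rewrite (big_ord_widen _ (fun k => f i k * e k j) (ltnW (ltn_ord j))).
  by apply: eq_bigr => k ->.
by move=> k _; rewrite !mxE.
Qed.

Lemma sum_last1 (f : nat -> R) (a : R) m :
  \sum_(k < m.+1) f k * (if k.+1 == m.+1 then a else 0) = f m * a.
Proof.
rewrite big_ord_recr /= eqxx big1 ?add0r // => -[k /= k_lt] _.
by rewrite eqSS ltn_eqF // mulr0.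
Qed.

Lemma sum_last2 (f : nat -> R) (a b : R) m :
  \sum_(k < m.+2) f k *
    (if k.+1 == m.+2 then a else if k.+2 == m.+2 then b else 0) =
  f m.+1 * a + f m * b.
Proof.
rewrite big_ord_recr /= eqxx addrC; congr (_ + _).
rewrite -sum_last1; apply: eq_bigr => -[k /= k_lt] _.
by rewrite !eqSS (ltn_eqF k_lt).
Qed.

(* The (1-based) column j + 1 of the symplectic Jacobi-Trudi matrix, for a row
   with s = lambda_i - i. *)
Definition sp_entry (H : int -> R) (j : nat) (s : int) : R :=
  H (s + j%:Z) + (if j is 0 then 0 else H (s - j%:Z)).

(** Adding the rows shifted by 1 and by -1 turns a column into the sum of its neighbours, just as
    multiplication by z + z^-1 acts on z^j + z^-j. *)
Lemma sp_entry_rec0 (H : int -> R) s :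
  sp_entry H 0 (s + 1) + sp_entry H 0 (s - 1) = sp_entry H 1 s.
Proof. by rewrite /sp_entry !addr0. Qed.

(** Column 0 carries one copy of H(s) where the general pattern would give two, hence the
    doubling. *)
Lemma sp_entry_rec1 (H : int -> R) s :
  sp_entry H 1 (s + 1) + sp_entry H 1 (s - 1) =
  sp_entry H 2 s + (sp_entry H 0 s) *+ 2.
Proof.
rewrite /sp_entry !addr0 !subrK addrK -!addrA.
rewrite (_ : 1 + 1%:Z = 2) // -opprD (_ : 1 + 1%:Z = 2) // mulr2n.
by ring.
Qed.

Lemma sp_entry_rec (H : int -> R) j s :
  sp_entry H j.+2 (s + 1) + sp_entry H j.+2 (s - 1) =
  sp_entry H j.+3 s + sp_entry H j.+1 s.
Proof.
rewrite /sp_entry.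
rewrite (_ : s + 1 + j.+2%:Z = s + j.+3%:Z); last by lia.
rewrite (_ : s + 1 - j.+2%:Z = s - j.+1%:Z); last by lia.
rewrite (_ : s - 1 + j.+2%:Z = s + j.+1%:Z); last by lia.
rewrite (_ : s - 1 - j.+2%:Z = s - j.+3%:Z); last by lia.
by ring.
Qed.

(** This is [sp_entry] at s = 0 for the sequence k -> z^k, with [zi] standing for z^-1. *)
Definition laurent_entry (z zi : R) (j : nat) : R :=
  z ^+ j + (if j is 0 then 0 else zi ^+ j).

(** The top row is kept free so that the Laurent row in z can later be replaced by the row of a new
    part, with the same cofactors. *)
Definition sp_rows (top : nat -> R) (H : int -> R) (s : nat -> int)
    (i j : nat) : R :=
  if i is i'.+1 then sp_entry H j (s i') else top j.

(* Past its first entry, the top row of the matrix on the left is annihilated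
   by the Chebyshev recursion in z + z^-1; here zi plays z^-1. *)
Lemma det_sp_step n (H : int -> R) (s : nat -> int) (z zi : R) : z * zi = 1 ->
  \det (\matrix_(i < n.+1, j < n.+1)
    sp_rows (laurent_entry z zi) H s i j) =
  \det (\matrix_(i < n, j < n)
    sp_entry (fun k => H k - (z + zi) * H (k - 1) + H (k - 2)) j (s i + 1)).
Proof.
move=> zzi; set f := sp_rows _ _ _.
(* Column j receives -(z + zi) times column j - 1 plus column j - 2; the coefficient 2 makes up for
   the single copy in column 0. *)
pose e (k j : nat) := if k.+1 == j then - (z + zi) else
  if k.+2 == j then (if k is 0 then 2 else 1) else 0 : R.
rewrite -(det_column_operation _ f e) (expand_det_row _ ord0).
have fe0 i : f i 0 + \sum_(k < 0) f i k * e k 0 = f i 0 by rewrite big_ord0 addr0.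
have fe1 i : f i 1 + \sum_(k < 1) f i k * e k 1 = f i 1 - (z + zi) * f i 0.
  by rewrite sum_last1 mulrN mulrC.
have fe2 i j : f i j.+2 + \sum_(k < j.+2) f i k * e k j.+2 =
    f i j.+2 - (z + zi) * f i j.+1 + f i j * (if j is 0 then 2 else 1).
  rewrite -addrA -mulNr [- (z + zi) * _]mulrC -sum_last2; congr (_ + _).
  apply: eq_bigr => -[k /= k_lt] _; rewrite /e; case: ifP => // _.
  by case: ifP => // /eqP[->].
have row0 j : f 0 j.+1 + \sum_(k < j.+1) f 0 k * e k j.+1 = 0.
  case: j => [|[|j]]; rewrite ?fe1 ?fe2 /f /= /laurent_entry.
  - by rewrite expr0 addr0 mulr1 !expr1 subrr.
  (* The relation z zi = 1 enters by inserting the factor z zi, after which the identity holds for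
     independent z and zi. *)
  - rewrite expr0 addr0 mul1r !expr1 (_ : 2 = (z * zi) *+ 2); [ring | by rewrite zzi].
  - rewrite mulr1 (_ : z ^+ j.+1 + zi ^+ j.+1 =
        z * zi * (z ^+ j.+1 + zi ^+ j.+1)); last by rewrite zzi mul1r.
    rewrite !exprS; ring.
rewrite big_ord_recl big1 => [|j _]; last first.
  by rewrite mxE; apply: etrans (mul0r _); congr (_ * _); exact: row0.
rewrite mxE [X in X * _](_ : _ = 1); last first.
  by rewrite fe0 /f /= /laurent_entry expr0 addr0.
rewrite mul1r addr0 /cofactor expr0 mul1r.
congr (\det _); apply/matrixP => i j; rewrite !mxE.
rewrite [LHS](_ : _ = f i.+1 j.+1 + \sum_(k < j.+1) f i.+1 k * e k j.+1) //.
(* The column recursion merges columns j + 1 and j - 1 into column j at the arguments s + 1 and s -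
   1. *)
rewrite [RHS](_ : _ = sp_entry H j (s i + 1) - (z + zi) * sp_entry H j (s i) +
    sp_entry H j (s i - 1)).
  case: (j : nat) => [|[|k]]; rewrite ?fe1 ?fe2 /f /= [RHS]addrAC.
  - by rewrite sp_entry_rec0.
  - by rewrite sp_entry_rec1 addrAC mulr_natr.
  - by rewrite sp_entry_rec addrAC mulr1.
rewrite /sp_entry; case: (j : nat) => [|k].
  by rewrite !addr0 addrK (_ : s i + 1 - 2 = s i - 1) //; ring.
rewrite (_ : s i + 1 + k.+1%:Z - 1 = s i + k.+1%:Z); last by ring.
rewrite (_ : s i + 1 + k.+1%:Z - 2 = s i - 1 + k.+1%:Z); last by ring.
rewrite (_ : s i + 1 - k.+1%:Z - 1 = s i - k.+1%:Z); last by ring.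
rewrite (_ : s i + 1 - k.+1%:Z - 2 = s i - 1 - k.+1%:Z); last by ring.
by ring.
Qed.

(** The cofactors along the top row do not involve that row, so they can be read off the matrix
    whose top row is zero. *)
Lemma det_sp_rows n (top : nat -> R) (H : int -> R) (s : nat -> int) :
  \det (\matrix_(i < n.+1, j < n.+1) sp_rows top H s i j) =
  \sum_(j < n.+1) top j *
    cofactor (\matrix_(i < n.+1, j < n.+1) sp_rows (fun=> 0) H s i j) ord0 j.
Proof.
rewrite (expand_det_row _ ord0); apply: eq_bigr => j _; rewrite mxE.
congr (_ * _); rewrite /cofactor; congr (_ * \det _).
by apply/matrixP => i k; rewrite !mxE.
Qed.

End ColumnOperations.

(** * Evaluation of monomials and translation of the Fock variables *)

Section MonomialEvaluation.
Variables (I : choiceType) (S : comNzRingType) (g : I -> S).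

Definition meval (m : {cmonom I}) : S := \prod_(i <- finsupp m) g i ^+ m i.

Lemma mevalEw (m : {cmonom I}) (d : {fset I}) : (finsupp m `<=` d)%fset ->
  meval m = \prod_(i <- d) g i ^+ m i.
Proof.
move=> md; rewrite /meval (big_fset_incl _ md) // => i _.
by rewrite -cmE_neq0 negbK => /eqP ->.
Qed.

Lemma meval_mmorphism : mmorphism meval.
Proof.
split=> [m1 m2|]; last by rewrite /meval mdom1 big_seq_fset0.
rewrite /meval mdomD -[in RHS]/(meval m1) -[in RHS]/(meval m2).
rewrite (mevalEw (fsubsetUl _ (finsupp m2))) (mevalEw (fsubsetUr (finsupp m1) _)).
by rewrite -big_split; apply: eq_bigr => i _; rewrite cmM exprD.
Qed.

HB.instance Definition _ :=
  isMultiplicative.Build {cmonom I} S meval meval_mmorphism.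

Lemma mevalU i : meval (ucm i) = g i.
Proof. by rewrite /meval mdomU big_seq_fset1 cmUU expr1. Qed.

End MonomialEvaluation.

(** Being a ring morphism, the substitution passes through determinants, which is not apparent for
    an exponential of operators. *)
HB.lock Definition translate (F : fieldType) (c : nat -> F) :
    {malg F[{cmonom nat}]} -> {malg F[{cmonom nat}]} :=
  mmap (@malgC {cmonom nat} F) (meval (fun i => fockX F i + (c i)%:MP)).

Lemma translate_additive (F : fieldType) (c : nat -> F) : additive (translate c).
Proof. by rewrite unlock; exact: raddfB. Qed.

Lemma translate_multiplicative (F : fieldType) (c : nat -> F) :
  multiplicative (translate c).
Proof. by rewrite unlock; split; [exact: rmorphM | exact: rmorph1]. Qed.

HB.instance Definition _ (F : fieldType) (c : nat -> F) :=
  GRing.isAdditive.Build _ _ (translate c) (translate_additive c).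
HB.instance Definition _ (F : fieldType) (c : nat -> F) :=
  GRing.isMultiplicative.Build _ _ (translate c) (translate_multiplicative c).

(** * The weight filtration and Taylor's formula on Fock space *)

Section FockSpace.
Variable F : fieldType.
Hypothesis charF0 : [pchar F] =i pred0.
Local Notation fock := {malg F[{cmonom nat}]}.
Local Notation X := (@fockX F).

Lemma natF_neq0 n : n.+1%:R != 0 :> F.
Proof. by rewrite ((pcharf0P F).1 charF0). Qed.

Lemma fock_natI n (v : fock) : v *+ n.+1 = 0 -> v = 0.
Proof.
move/eqP; rewrite -scaler_nat scaler_eq0 (negPf (natF_neq0 n)) /=.
by move/eqP.
Qed.

Lemma fock_monomial_ind (P : {cmonom nat} -> Prop) :
  P mone -> (forall i m, P m -> P (mmul (ucm i) m)) -> forall m, P m.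
Proof.
move=> P1 PM m; have [d] := ubnP (mdeg m); elim: d m => // d IH m m_lt.
have [m0 | m0] := eqVneq (mdeg m) 0%N; first by rewrite (mdeg_eq0I m0).
have [i im] : exists i, m i != 0%N.
  case: (finsupp m =P fset0) => [m_supp | /eqP/fset0Pn[i]].
    by move: m0; rewrite mdegE m_supp big_seq_fset0.
  by rewrite -cmE_neq0 => ?; exists i.
have mE : mmul (ucm i) (divcm m (ucm i)) = m.
  apply/eqP/cmP => j; rewrite cmM divcmE subnKC // cmU.
  by case: eqP => // <-; rewrite lt0n.
rewrite -mE; apply: PM; apply: IH; move: m_lt.
by rewrite -{1}mE mdegM mdegU.
Qed.

Lemma fock_ind (P : fock -> Prop) :
  P 0 -> P 1 -> (forall c u v, P u -> P v -> P (c *: u + v)) ->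
  (forall i v, P v -> P (X i * v)) -> forall v, P v.
Proof.
move=> P0 P1 PL PX v; rewrite [v]monalgE.
have PU m : P << m >>.
  elim/fock_monomial_ind: m; first exact: P1.
  move=> i m Pm; rewrite (_ : << mmul (ucm i) m >> = X i * << m >>); first exact: PX.
  by rewrite /fockX malgM_def fgmulUU mulr1.
apply: (big_ind P); first exact: P0.
  by move=> u w Pu Pw; rewrite -[u]scale1r; apply: PL.
move=> m _; rewrite (_ : << v@_m *g m >> = v@_m *: << m >> + 0).
  by apply: PL; [exact: PU | exact: P0].
rewrite addr0; move: (v@_m) => c; apply/malgP => k.
by rewrite mcoeffZ [LHS]mcoeffU [in RHS]mcoeffU mulr_natr.
Qed.

Lemma fockXU i : X i = << ucm i >>.
Proof. by []. Qed.

Lemma fockD_linear n : linear (@fockD F n).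
Proof.
move=> c u v; apply/malgP => m.
by rewrite mcoeffD mcoeffZ !fockDE mcoeffD mcoeffZ mulrnDl mulrnAr.
Qed.

HB.instance Definition _ n :=
  GRing.isLinear.Build F fock fock _ (@fockD F n) (fockD_linear n).

Lemma fockD1 n : fockD n (1 : fock) = 0.
Proof.
by apply/malgP => m; rewrite fockDE mcoeff0 mcoeff1 cmM_eq1 cm1_eq1 andbF mul0rn.
Qed.

(* The filtration in which a_{-n} has weight n; it bounds the support of every
   locally finite sum evaluated at a vector. *)
Inductive wt_le : int -> fock -> Prop :=
| Wt0 w : wt_le w 0
| Wt1 w : 0 <= w -> wt_le w 1
| WtL w c u v : wt_le w u -> wt_le w v -> wt_le w (c *: u + v)
| WtX w i v : wt_le w v -> wt_le (w + i.+1%:Z) (X i * v).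

Lemma wt_leW w w' v : w <= w' -> wt_le w v -> wt_le w' v.
Proof.
move=> ww' wv; elim: wv w' ww' => {w v}.
- by move=> *; apply: Wt0.
- by move=> w w0 w' ww'; apply: Wt1; apply: le_trans ww'.
- by move=> w c u v _ IHu _ IHv w' ww'; apply: WtL; [apply: IHu | apply: IHv].
move=> w i v _ IH w' ww'; rewrite -(subrK i.+1%:Z w'); apply/WtX/IH.
by rewrite lerBrDr.
Qed.

Lemma wt_leZ w c v : wt_le w v -> wt_le w (c *: v).
Proof. by move=> wv; rewrite -[_ *: _]addr0; apply: WtL => //; apply: Wt0. Qed.

Lemma wt_leD w u v : wt_le w u -> wt_le w v -> wt_le w (u + v).
Proof. by move=> wu wv; rewrite -[u]scale1r; apply: WtL. Qed.

Lemma wt_le_sum w (T : Type) (r : seq T) (P : pred T) (f : T -> fock) :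
  (forall i, P i -> wt_le w (f i)) -> wt_le w (\sum_(i <- r | P i) f i).
Proof. by move=> ?; apply: (big_ind (wt_le w)) => //; [apply: Wt0 | apply: wt_leD]. Qed.

Lemma wt_le_neg w v : wt_le w v -> w < 0 -> v = 0.
Proof.
elim=> {w v} //.
- by move=> w w0 /(le_lt_trans w0).
- by move=> w c u v _ IHu _ IHv w0; rewrite IHu // IHv // scaler0 addr0.
by move=> w i v _ IH w0; rewrite IH ?mulr0 //; lia.
Qed.

Lemma wt_le_ex v : exists w : nat, wt_le w%:Z v.
Proof.
elim/fock_ind: v.
- by exists 0%N; apply: Wt0.
- by exists 0%N; apply: Wt1.
- move=> c u v [wu Hu] [wv Hv]; exists (wu + wv)%N.
  by apply: WtL; [apply: wt_leW Hu | apply: wt_leW Hv]; lia.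
by move=> i v [w Hw]; exists (w + i.+1)%N; rewrite PoszD; apply: WtX.
Qed.

Lemma wt_fockD w n v : wt_le w v -> wt_le (w - n.+1%:Z) (fockD n v).
Proof.
elim=> {w v}.
- by move=> w; rewrite raddf0; apply: Wt0.
- by move=> w _; rewrite fockD1; apply: Wt0.
- by move=> w c u v _ IHu _ IHv; rewrite linearP; apply: WtL.
move=> w i v wv IH; rewrite fockD_fockX; apply: wt_leD.
  by rewrite addrAC; apply: WtX.
case: eqP => [-> | _]; last exact: Wt0.
by rewrite addrK.
Qed.

Lemma fockD_wt0 w n v : wt_le w%:Z v -> (w <= n)%N -> fockD n v = 0.
Proof. by move=> /(wt_fockD n) /wt_le_neg wD wn; apply: wD; lia. Qed.

Definition delta (c : nat -> F) (v : fock) : fock :=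
  \sum_(n \in [set: nat]) c n *: fockD n v.

Lemma deltaE c (w : nat) v (M : nat) : wt_le w%:Z v -> (w <= M)%N ->
  delta c v = \sum_(n < M) c n *: fockD n v.
Proof.
move=> wv wM; apply: fsum_nat => n Mn.
by rewrite (fockD_wt0 wv) ?scaler0 // (leq_trans wM).
Qed.

Lemma delta_linear c : linear (delta c).
Proof.
move=> a u v; have [wu Hu] := wt_le_ex u; have [wv Hv] := wt_le_ex v.
have Hw : wt_le (wu + wv)%N (a *: u + v).
  by apply: WtL; [apply: wt_leW Hu | apply: wt_leW Hv]; lia.
rewrite (deltaE _ Hw (leqnn _)) (deltaE _ Hu (leq_addr wv _)).
rewrite (deltaE _ Hv (leq_addl wu _)) scaler_sumr -big_split.
apply: eq_bigr => n _; rewrite linearP scalerDr !scalerA.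
by rewrite [c n * a]mulrC.
Qed.

HB.instance Definition _ c :=
  GRing.isLinear.Build F fock fock _ (delta c) (delta_linear c).

Lemma delta_fockX c i v : delta c (X i * v) = X i * delta c v + c i *: v.
Proof.
have [w Hw] := wt_le_ex v; have Hx := WtX i Hw; rewrite -PoszD in Hx.
rewrite (deltaE _ Hx (leqnn _)) (deltaE _ Hw (leq_addr i.+1 w)) mulr_sumr.
rewrite (eq_bigr (fun n : 'I__ => X i * (c n *: fockD n v) +
    (if n == i :> nat then c n *: v else 0))).
  rewrite big_split; congr (_ + _) => /=.
  have iw : (i < w + i.+1)%N by rewrite addnS ltnS leq_addl.
  rewrite (bigD1 (Ordinal iw)) //= eqxx big1 ?addr0 // => n.
  by rewrite -val_eqE => /negbTE /= ->.
move=> n _; rewrite fockD_fockX scalerDr scalerAr; congr (_ + _).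
by case: eqP; rewrite ?scaler0.
Qed.

Lemma wt_delta c w v : wt_le w v -> wt_le (w - 1) (delta c v).
Proof.
move=> wv; have [w' Hw'] := wt_le_ex v.
rewrite (deltaE _ Hw' (leqnn _)); apply: wt_le_sum => n _; apply: wt_leZ.
by apply: wt_leW (wt_fockD n wv); lia.
Qed.

Lemma wt_iter_delta c w v m : wt_le w v -> wt_le (w - m%:Z) (iter m (delta c) v).
Proof.
move=> wv; elim: m => [|m IH] /=; first by rewrite subr0.
by apply: wt_leW (wt_delta c IH); lia.
Qed.

Lemma opexp_deltaE c (w : nat) v M : wt_le w%:Z v -> (w < M)%N ->
  opexp (delta c) v = \sum_(m < M) (m`!%:R)^-1 *: iter m (delta c) v.
Proof.
move=> wv wM; apply: fsum_nat => m Mm.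
by rewrite (wt_le_neg (wt_iter_delta c m wv)) ?scaler0 //; lia.
Qed.

Lemma iter_delta_linear c m a u v :
  iter m (delta c) (a *: u + v) = a *: iter m (delta c) u + iter m (delta c) v.
Proof. by elim: m => //= m ->; rewrite linearP. Qed.

Lemma opexp_delta_linear c : linear (opexp (delta c)).
Proof.
move=> a u v; have [wu Hu] := wt_le_ex u; have [wv Hv] := wt_le_ex v.
have Hw : wt_le (wu + wv)%N (a *: u + v).
  by apply: WtL; [apply: wt_leW Hu | apply: wt_leW Hv]; lia.
rewrite (opexp_deltaE _ Hw (leqnn _)).
rewrite (@opexp_deltaE c wu u (wu + wv).+1 Hu) ?ltnS ?leq_addr //.
rewrite (@opexp_deltaE c wv v (wu + wv).+1 Hv) ?ltnS ?leq_addl //.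
rewrite scaler_sumr -big_split; apply: eq_bigr => m _.
rewrite iter_delta_linear scalerDr !scalerA.
by rewrite [_^-1 * a]mulrC.
Qed.

(** Leibniz rule for a power of a derivation: [X i] is sent to a constant, so two terms survive. For
    m = 0 the coefficient [m%:R] kills the term with the default value of [m.-1]. *)
Lemma iter_delta_fockX c i v m :
  iter m (delta c) (X i * v) =
  X i * iter m (delta c) v + (m%:R * c i) *: iter m.-1 (delta c) v.
Proof.
elim: m => [|m IH]; first by rewrite mul0r scale0r addr0.
rewrite iterS IH linearD linearZ /= delta_fockX -addrA; congr (_ + _).
case: m {IH} => [|m]; first by rewrite mul0r scale0r addr0 mul1r.
by rewrite -iterS -scalerDl -[X in X + _]mul1r -mulrDl addrC natr1.
Qed.

Lemma opexp_delta_fockX c i v :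
  opexp (delta c) (X i * v) = X i * opexp (delta c) v + c i *: opexp (delta c) v.
Proof.
have [w Hw] := wt_le_ex v; have Hx := WtX i Hw; rewrite -PoszD in Hx.
(* With this bound, M + 1 terms suffice for both [X i * v] and [v], and M terms still suffice for
   [v] after the index shift m -> m + 1. *)
pose M := (w + i.+1)%N.
rewrite (opexp_deltaE _ Hx (leqnn _)) (@opexp_deltaE c w v M.+1 Hw); last first.
  by rewrite ltnS leq_addr.
have mul_sum (f : 'I_M.+1 -> fock) : X i * (\sum_m f m) = \sum_m X i * f m.
  exact: mulr_sumr.
rewrite {}mul_sum.
transitivity (\sum_(m < M.+1) (X i * ((m`!%:R)^-1 *: iter m (delta c) v) +
    ((m`!%:R)^-1 * (m%:R * c i)) *: iter m.-1 (delta c) v)).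
  apply: eq_bigr => m _.
  by rewrite iter_delta_fockX scalerDr scalerA scalerAr.
rewrite big_split; congr (_ + _).
rewrite -[LHS]/(\sum_(m < M.+1) ((m`!%:R)^-1 * (m%:R * c i)) *: iter m.-1 (delta c) v).
rewrite [LHS]big_ord_recl.
rewrite mul0r mulr0 scale0r add0r -(@opexp_deltaE c w v M.+1 Hw) ?ltnS ?leq_addr //.
have wM : (w < M)%N by rewrite /M addnS ltnS leq_addr.
rewrite (@opexp_deltaE c w v M Hw wM) scaler_sumr.
apply: eq_bigr => m _; rewrite [RHS]scalerA lift0 succnK.
have -> : (m.+1`!%:R)^-1 * (m.+1%:R * c i) = c i * (m`!%:R)^-1.
  by rewrite factS natrM invfM mulrACA mulVf ?natF_neq0 // mul1r mulrC.
by [].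
Qed.

Lemma translateX (c : nat -> F) i : translate c (X i) = X i + (c i)%:MP.
Proof. by rewrite unlock fockXU mmapU mevalU /= mpolyC1E mul1r. Qed.

Lemma translateZ (c : nat -> F) (a : F) (v : fock) :
  translate c (a *: v) = a *: translate c v.
Proof. by rewrite unlock mmapZ mul_malgC. Qed.

Lemma translateC (c : nat -> F) (a : F) : translate c a%:MP = a%:MP.
Proof. by rewrite unlock; exact: mmapC. Qed.

(** Taylor's formula. Both sides are linear, fix the vacuum and turn multiplication by [X i] into
    multiplication by X_i + c_i. *)
Lemma opexp_delta c : opexp (delta c) =1 translate c.
Proof.
elim/fock_ind.
- by rewrite rmorph0 (@opexp_deltaE c 0 0 1 (Wt0 _) isT) big_ord1 scaler0.
- rewrite rmorph1 (@opexp_deltaE c 0 1 1 (Wt1 (lexx _)) isT) big_ord1.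
  by rewrite fact0 invr1 scale1r.
- by move=> a u v IHu IHv; rewrite opexp_delta_linear rmorphD /= translateZ IHu IHv.
move=> i v IH; rewrite opexp_delta_fockX IH rmorphM /= translateX mulrDl.
by rewrite -[c i *: _]mul_malgC.
Qed.

Lemma translateD (c d : nat -> F) (v : fock) :
  translate c (translate d v) = translate (fun i => c i + d i) v.
Proof.
elim/fock_ind: v.
- by rewrite !rmorph0.
- by rewrite !rmorph1.
- by move=> a u v IHu IHv; rewrite !rmorphD /= !translateZ IHu IHv.
move=> i v IH; rewrite !rmorphM /= IH !translateX; congr (_ * _).
rewrite rmorphD /= [X in X + _]translateX [X in _ + X]translateC -addrA.
congr (_ + _).
by apply/esym; exact: monalgUD.
Qed.

Lemma translate0 (v : fock) : translate (fun=> 0) v = v.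
Proof.
elim/fock_ind: v.
- by rewrite rmorph0.
- by rewrite rmorph1.
- by move=> a u v IHu IHv; rewrite rmorphD /= translateZ IHu IHv.
by move=> i v IH; rewrite rmorphM /= translateX IH malgC0E addr0.
Qed.

Lemma eq_translate (c d : nat -> F) : c =1 d -> translate c =1 translate d.
Proof. by move=> /funext ->. Qed.

End FockSpace.

(** * Coefficients of powers of a polynomial *)

Section PolynomialPowers.
Variable R : comNzRingType.

Lemma mul_swap (a b c : R) : a * (b * c) = b * a * c.
Proof. by rewrite mulrCA mulrA. Qed.

Lemma coef_deriv_exp (p : {poly R}) m n :
  (p ^+ m.+1)`_n.+1 *+ n.+1 =
  (\sum_(i < n.+1) (p`_i.+1 *+ i.+1) * (p ^+ m)`_(n - i)) *+ m.+1.
Proof.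
rewrite -coef_deriv deriv_exp coefMn coefM; congr (_ *+ _).
by apply: eq_bigr => i _; rewrite coef_deriv.
Qed.

Lemma coef_exp_small (p : {poly R}) m n : p`_0 = 0 -> (n < m)%N -> (p ^+ m)`_n = 0.
Proof.
move=> p0; elim: m n => // m IH n n_lt; rewrite exprSr coefM big1 // => -[i /= i_lt] _.
have [i_lt_m | m_le_i] := ltnP i m; first by rewrite IH ?mul0r.
have -> : (n - i = 0)%N by lia.
by rewrite p0 mulr0.
Qed.

End PolynomialPowers.

(** * The creation half as multiplication by complete symmetric functions *)

Section CreationModes.
Variable F : fieldType.
Hypothesis charF0 : [pchar F] =i pred0.
Local Notation fock := {malg F[{cmonom nat}]}.
Local Notation X := (@fockX F).
Local Notation C := (@creation_series F).

Lemma fsum_int_nonneg (V : zmodType) (f : int -> V) (n : nat) :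
    (forall k : int, k < 0 -> f k = 0) -> (forall k, (n < k)%N -> f k%:Z = 0) ->
  \sum_(k \in [set: int]) f k = \sum_(i < n.+1) f i%:Z.
Proof.
move=> f_neg f_large; rewrite (fsum_int (M := n)).
  rewrite big_ord_recl; congr (_ + _); apply: eq_bigr => i _.
  by rewrite lift0 [X in _ + X]f_neg ?addr0 //; lia.
by case=> k k_gt; [exact: f_large | exact: f_neg].
Qed.

Lemma opsXS (V : lmodType F) (A : opseries V) m n v :
  opsX A m.+1 n v = \sum_(k \in [set: int]) A (n - k) (opsX A m k v).
Proof. by []. Qed.

(** Creation operators act by multiplication, so the operator series is a power series over Fock
    space; this truncation computes its coefficients up to degree [M]. *)
Definition creation_poly (M : nat) : {poly fock} :=
  \poly_(i < M.+1) (if i is i'.+1 then (i'.+1%:R : F)^-1 *: X i' else 0).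

Lemma coef_creation_poly0 M : (creation_poly M)`_0 = 0.
Proof. by rewrite coef_poly. Qed.

Lemma coef_creation_poly M i : (i < M)%N ->
  (creation_poly M)`_i.+1 = (i.+1%:R : F)^-1 *: X i.
Proof. by move=> iM; rewrite coef_poly ltnS iM. Qed.

Lemma creation_neg (k : int) v : k <= 0 -> C k v = 0.
Proof. by move=> k0; rewrite /creation_series ltNge k0. Qed.

Lemma creation_vec0 k : C k 0 = 0.
Proof.
rewrite /creation_series; case: ifP => // k0; case: k k0 => [[|k]|k] // _.
by rewrite /= mulr0 scaler0.
Qed.

Lemma creation_pos M (i : nat) v : (i <= M)%N -> C i%:Z v = (creation_poly M)`_i * v.
Proof.
case: i => [|i] iM; first by rewrite creation_neg // coef_creation_poly0 mul0r.
by rewrite coef_creation_poly // -scalerAl.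
Qed.

Lemma opsX_creation_neg m (k : int) v : k < 0 -> opsX C m k v = 0.
Proof.
elim: m k => [|m IH] k k0; first by rewrite /opsX /= /ops1 lt_eqF.
rewrite opsXS fsbig1 // => j _.
have [j0 | j0] := ltP j 0; first by rewrite IH // creation_vec0.
by rewrite creation_neg //; lia.
Qed.

Lemma opsX_creation M m (n : nat) v : (n <= M)%N ->
  opsX C m n%:Z v = (creation_poly M ^+ m)`_n * v.
Proof.
elim: m n => [|m IH] n nM.
  by rewrite expr0 coef1 /opsX /= /ops1; case: n nM => [|n] _; rewrite ?mul1r ?mul0r.
rewrite exprSr coefM mulr_suml.
rewrite opsXS (fsum_int_nonneg (n := n)).
- apply: eq_bigr => -[i /= i_lt] _.
  rewrite IH; last by lia.
  rewrite subzn; last by lia.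
  rewrite (creation_pos (M := M)); last by lia.
  exact: mul_swap.
- by move=> k k0; rewrite opsX_creation_neg // creation_vec0.
- by move=> k k_gt; rewrite creation_neg //; lia.
Qed.

(** With a_{-n} read as the n-th power sum, this is the complete symmetric function of degree n. *)
Definition hfock (n : nat) : fock := opsexp C n%:Z 1.

Lemma hfockE M (n : nat) : (n < M)%N ->
  hfock n = \sum_(m < M) (m`!%:R : F)^-1 *: (creation_poly M ^+ m)`_n.
Proof.
move=> nM; rewrite /hfock /opsexp (fsum_nat (M := M)).
  by apply: eq_bigr => m _; rewrite (@opsX_creation M) ?mulr1 // ltnW.
move=> m Mm; rewrite (@opsX_creation M) ?mulr1; last exact: ltnW.
by rewrite coef_exp_small ?scaler0 ?coef_creation_poly0 // (leq_trans nM).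
Qed.

Lemma creation_modeE (k : int) v : opsexp C k v = zext hfock k * v.
Proof.
case: k => n; last first.
  rewrite mul0r [LHS]fsbig1 // => m _.
  by rewrite opsX_creation_neg ?scaler0.
rewrite [zext _ _](hfockE (ltnSn n)) mulr_suml /opsexp (fsum_nat (M := n.+1)).
  by apply: eq_bigr => m _; rewrite (@opsX_creation n.+1) // scalerAl.
move=> m nm; rewrite (@opsX_creation n.+1) //.
by rewrite coef_exp_small ?mul0r ?scaler0 ?coef_creation_poly0.
Qed.

(** Coefficient form of exp(p)' = p' exp(p), obtained one power p^m at a time; the coefficients of
    p' are the variables themselves. *)
Lemma newton_hfock : newton X hfock.
Proof.
split=> [|n].
  by rewrite (@hfockE 1) // big_ord1 expr0 coef1 fact0 invr1 scale1r.
rewrite (@hfockE n.+2) // [X in _ * X]big_ord_recl expr0 coef1 scaler0 add0r.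
rewrite mulr_sumr.
transitivity (\sum_(m < n.+1) \sum_(i < n.+1)
   X i * ((m`!%:R : F)^-1 *: (creation_poly n.+2 ^+ m)`_(n - i))).
  apply: eq_bigr => m _; rewrite lift0 mulr_natl scalerMnr coef_deriv_exp.
  rewrite -scaler_nat scalerA scaler_sumr.
  have -> : (m.+1`!%:R)^-1 * m.+1%:R = (m`!%:R)^-1 :> F.
    by rewrite factS natrM invfM mulrAC mulVf ?mul1r // natF_neq0.
  apply: eq_bigr => -[i /= i_lt] _; rewrite coef_creation_poly; last by lia.
  rewrite -scaler_nat scalerA mulfV ?natF_neq0 // scale1r.
  by rewrite scalerAr.
rewrite exchange_big; apply: eq_bigr => -[i /= i_lt] _.
rewrite -mulr_sumr; congr (_ * _).
rewrite (@hfockE n.+2); last by lia.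
rewrite [RHS]big_ord_recr /= [X in _ + X](_ : _ = 0) ?addr0 //.
by rewrite coef_exp_small ?scaler0 ?coef_creation_poly0 //; lia.
Qed.

End CreationModes.

(** * The annihilation half and its values at nonzero scalars *)

Section AnnihilationModes.
Variable F : fieldType.
Hypothesis charF0 : [pchar F] =i pred0.
Local Notation fock := {malg F[{cmonom nat}]}.
Local Notation A := (@annihilation_series F).
Implicit Types (v : fock) (w : nat).

Lemma annihilationE (k : int) v :
  A k v = if k == 0 then 0 else - fockD `|k|.-1 v.
Proof.
rewrite /annihilation_series; case: eqVneq => // k0; congr (- _).
have -> : `|k|%R = (`|k|%N.-1).+1 :> int by lia.
by rewrite /= scalerA mulVf ?scale1r // natF_neq0.
Qed.

Lemma annihilation_vec0 k : A k 0 = 0.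
Proof. by rewrite annihilationE raddf0 oppr0; case: ifP. Qed.

Lemma wt_leN (x : int) v : wt_le x v -> wt_le x (- v).
Proof. by rewrite -scaleN1r; exact: wt_leZ. Qed.

(** Two bounds are used: the drop by |k| confines the Laurent degree, and the drop by 1 in
    [wt_annihilation1] bounds the order in the exponential. *)
Lemma wt_annihilation (k x : int) v : wt_le x v -> wt_le (x - `|k|%N%:Z) (A k v).
Proof.
move=> xv; rewrite annihilationE; case: eqVneq => [_|k0]; first exact: Wt0.
by apply/wt_leN/(wt_leW _ (wt_fockD `|k|.-1 xv)); lia.
Qed.

Lemma wt_annihilation1 (k x : int) v : wt_le x v -> wt_le (x - 1) (A k v).
Proof.
move=> xv; rewrite annihilationE; case: eqVneq => [_|k0]; first exact: Wt0.
by apply/wt_leN/(wt_leW _ (wt_fockD `|k|.-1 xv)); lia.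
Qed.

Lemma wt_opsX_annihilation m (k x : int) v : wt_le x v ->
  wt_le (x - `|k|%N%:Z) (opsX A m k v).
Proof.
move=> xv; elim: m k => [|m IH] k.
  by rewrite /opsX /= /ops1; case: eqVneq => [->|_]; rewrite ?subr0 //; apply: Wt0.
rewrite opsXS; apply: wt_le_sum => j _.
by apply: wt_leW (wt_annihilation _ (IH j)); lia.
Qed.

Lemma wt_opsX_annihilation1 m (k x : int) v : wt_le x v ->
  wt_le (x - m%:Z) (opsX A m k v).
Proof.
move=> xv; elim: m k => [|m IH] k.
  by rewrite /opsX /= /ops1; case: eqVneq => [_|_]; rewrite ?subr0 //; apply: Wt0.
rewrite opsXS; apply: wt_le_sum => j _.
by apply: wt_leW (wt_annihilation1 _ (IH j)); lia.
Qed.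

(* The power sums of -(z + z^-1), shifted by one. *)
Definition annihilation_psum (z : F) (i : nat) : F := - (z ^+ i.+1 + z^-1 ^+ i.+1).

Lemma fsum_annihilation (z a : F) v :
  \sum_(k \in [set: int]) (a * z ^ k) *: A k v = a *: delta (annihilation_psum z) v.
Proof.
have [w Hw] := wt_le_ex v.
rewrite (deltaE _ Hw (leqnn _)) scaler_sumr (fsum_int (M := w)); last first.
  by move=> k wk; rewrite (wt_le_neg (wt_annihilation k Hw)) ?scaler0 //; lia.
rewrite annihilationE eqxx scaler0 add0r; apply: eq_bigr => i _.
have -> : A i.+1%:Z v = - fockD i v by rewrite annihilationE.
have -> : A (- i.+1%:Z) v = - fockD i v by rewrite annihilationE.
rewrite !scalerN -opprD -scalerDl -mulrDr -scaleNr scalerA -mulrN.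
by rewrite -exprnN /annihilation_psum exprVn.
Qed.

(** Evaluation at z turns convolution of operator series into composition of operators, since z^n =
    z^k z^{n-k}. *)
Lemma iter_delta_annihilation (z : F) (z0 : z != 0) m v :
  \sum_(k \in [set: int]) z ^ k *: opsX A m k v =
  iter m (delta (annihilation_psum z)) v.
Proof.
have [w Hw] := wt_le_ex v.
have big0 j k : (w < `|k|)%N -> opsX A j k v = 0.
  by move=> wk; rewrite (wt_le_neg (wt_opsX_annihilation j k Hw)) //; lia.
elim: m => [|m IH].
  rewrite (fsum_single (a := 0)) ?expr0z ?scale1r // => k /negbTE k0.
  by rewrite /opsX /= /ops1 k0 scaler0.
have fsumE j : \sum_(k \in [set: int]) z ^ k *: opsX A j k v =
    \sum_(i < w.*2.+1) z ^ (i%:Z - w%:Z) *: opsX A j (i%:Z - w%:Z) v.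
  by rewrite (fsum_int_shift (M := w)) // => k wk; rewrite big0 ?scaler0.
apply: etrans (fsumE m.+1) _.
rewrite [RHS]iterS -(etrans (esym (fsumE m)) IH).
rewrite [RHS]raddf_sum.
transitivity (\sum_(i < w.*2.+1) \sum_(j < w.*2.+1)
    z ^ (j%:Z - w%:Z) *: A (j%:Z - w%:Z - (i%:Z - w%:Z)) (opsX A m (i%:Z - w%:Z) v)).
  rewrite exchange_big; apply: eq_bigr => i _.
  rewrite opsXS (fsum_int_shift (M := w)); last first.
    by move=> k wk; rewrite big0 ?annihilation_vec0.
  by rewrite scaler_sumr.
apply: eq_bigr => i _; move: (i%:Z - w%:Z) => k.
rewrite [RHS]linearZ /= -fsum_annihilation -[RHS](fsum_int_translate _ k).
rewrite [RHS](fsum_int_shift (M := w)); last first.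
  move=> n wn; rewrite (wt_le_neg (wt_annihilation _ (wt_opsX_annihilation m k Hw))).
    by rewrite scaler0.
  by lia.
have zE (n : int) : z ^ k * z ^ (n - k) = z ^ n by rewrite -expfzDr // addrC subrK.
by apply: eq_bigr => j _; rewrite zE.
Qed.

Local Notation Ann := (opsexp A).

Lemma opsexp_annihilationE (k : int) w v : wt_le w%:Z v ->
  Ann k v = \sum_(m < w.+1) (m`!%:R : F)^-1 *: opsX A m k v.
Proof.
move=> Hw; rewrite /opsexp (fsum_nat (M := w.+1)) // => m wm.
by rewrite (wt_le_neg (wt_opsX_annihilation1 m k Hw)) ?scaler0 //; lia.
Qed.

Lemma opsexp_annihilation0 (k : int) w v : wt_le w%:Z v -> (w < `|k|)%N ->
  Ann k v = 0.
Proof.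
move=> Hw wk; rewrite (opsexp_annihilationE _ Hw) big1 // => m _.
by rewrite (wt_le_neg (wt_opsX_annihilation m k Hw)) ?scaler0 //; lia.
Qed.

(** The modes are handled through these values at scalars and recovered from them by
    [fock_coef_uniq]. *)
Lemma translate_annihilation (z : F) (z0 : z != 0) v :
  \sum_(k \in [set: int]) z ^ k *: Ann k v = translate (annihilation_psum z) v.
Proof.
have [w Hw] := wt_le_ex v.
rewrite -(opexp_delta charF0) (opexp_deltaE _ Hw (ltnSn w)).
rewrite (fsum_int_shift (M := w)); last first.
  by move=> k wk; rewrite (opsexp_annihilation0 Hw) ?scaler0.
transitivity (\sum_(m < w.+1) \sum_(i < w.*2.+1)
  (m`!%:R : F)^-1 *: (z ^ (i%:Z - w%:Z) *: opsX A m (i%:Z - w%:Z) v)).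
  rewrite exchange_big; apply: eq_bigr => i _.
  rewrite (opsexp_annihilationE _ Hw) scaler_sumr; apply: eq_bigr => m _.
  by rewrite !scalerA mulrC.
apply: eq_bigr => m _; rewrite -(iter_delta_annihilation z0).
rewrite [in RHS](fsum_int_shift (M := w)) ?scaler_sumr // => k wk.
by rewrite (wt_le_neg (wt_opsX_annihilation m k Hw)) ?scaler0 //; lia.
Qed.

(** In characteristic zero 1, ..., n are distinct nonzero points, too many roots for a nonzero
    polynomial of degree below n; this is applied to each Fock monomial separately. *)
Lemma fock_coef_uniq n (a b : nat -> fock) :
  (forall z : F, z != 0 ->
    \sum_(i < n) z ^+ i *: a i = \sum_(i < n) z ^+ i *: b i) ->
  forall i, (i < n)%N -> a i = b i.
Proof.
move=> ab i i_lt; apply/malgP => m.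
pose p : {poly F} := \poly_(i < n) ((a i)@_m - (b i)@_m).
suff p0 : p = 0.
  by have := coef0 F i; rewrite -p0 coef_poly i_lt => /eqP; rewrite subr_eq0 => /eqP.
apply: (@roots_geq_poly_eq0 _ _ [seq k.+1%:R | k <- iota 0 n]).
- apply/allP => _ /mapP[k _ ->]; rewrite rootE horner_poly; apply/eqP.
  have := congr1 (mcoeff m) (ab _ (natF_neq0 charF0 k)).
  rewrite [LHS]raddf_sum [RHS]raddf_sum /= => /eqP.
  rewrite -subr_eq0 -sumrB => /eqP abk; apply: etrans _ abk.
  apply: eq_bigr => j _; rewrite [X in _ = X - _]mcoeffZ [X in _ = _ - X]mcoeffZ.
  by rewrite -mulrBr mulrC.
- rewrite map_inj_uniq ?iota_uniq // => j k; wlog jk : j k / (j <= k)%N => [wl|].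
    by have [jk | /ltnW kj] := leqP j k; [exact: wl | move=> /esym/(wl _ _ kj)].
  move=> /esym/eqP; rewrite -subr_eq0 -natrB // ((pcharf0P F).1 charF0) subSS.
  by rewrite subn_eq0 => kj; apply/eqP; rewrite eqn_leq jk.
- by rewrite size_map size_iota size_poly.
Qed.

End AnnihilationModes.

(** * Symmetric Laurent polynomials and transport along ring morphisms *)

Section LaurentCoefficients.
Variables (R : comNzRingType) (N : nat) (K : nat -> R).

(* The coefficient of z^k in sum_j (z^j + [j > 0] z^-j) K_j. *)
Definition laurent_coef (k : int) : R :=
  \sum_(j < N) ((k == j%:Z)%:R + (if (j : nat) is 0 then 0 else (k == - j%:Z)%:R)) * K j.

Lemma sum_pick M (g : int -> R) (k : int) : (`|k| <= M)%N ->
  \sum_(i < M.*2.+1) g (i%:Z - M%:Z) * (i%:Z - M%:Z == k)%:R = g k.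
Proof.
move=> kM; rewrite -(fsum_int_shift (f := fun n => g n * (n == k)%:R)).
  rewrite (fsum_single (a := k)) ?eqxx ?mulr1 // => n /negbTE ->.
  by rewrite mulr0.
by move=> n nM; rewrite (_ : n == k = false) ?mulr0 //; lia.
Qed.

Lemma sum_laurent_coef M (g : int -> R) : (N <= M)%N ->
  \sum_(i < M.*2.+1) g (i%:Z - M%:Z) * laurent_coef (i%:Z - M%:Z) =
  \sum_(j < N) (g j%:Z + (if (j : nat) is 0 then 0 else g (- j%:Z))) * K j.
Proof.
move=> NM.
transitivity (\sum_(i < M.*2.+1) \sum_(j < N)
  g (i%:Z - M%:Z) * (((i%:Z - M%:Z == j%:Z)%:R + (if (j : nat) is 0 then 0 else
    (i%:Z - M%:Z == - j%:Z)%:R)) * K j)).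
  by apply: eq_bigr => i _; rewrite /laurent_coef mulr_sumr.
rewrite exchange_big; apply: eq_bigr => -[j /= j_lt] _.
under eq_bigr do rewrite mulrA mulrDr.
rewrite -mulr_suml big_split /= sum_pick; last by lia.
congr ((_ + _) * _); case: j j_lt => [|j] j_lt.
  by rewrite big1 // => i _; rewrite mulr0.
by rewrite sum_pick //; lia.
Qed.

End LaurentCoefficients.

Lemma laurent_entry_rmorph (F : fieldType) (R : comNzRingType)
    (f : {rmorphism F -> R}) (z : F) (j : nat) :
  laurent_entry (f z) (f z^-1) j =
  f (z ^ j%:Z) + (if j is 0 then 0 else f (z ^ (- j%:Z))).
Proof.
rewrite /laurent_entry -!rmorphXn; case: j => // j.
by rewrite exprVn exprnN.
Qed.

Lemma annihilation_psum_rmorph (F : fieldType) (R : comNzRingType)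
    (f : {rmorphism F -> R}) (z : F) (i : nat) :
  f (annihilation_psum z i) = - f z ^+ i.+1 - f z^-1 ^+ i.+1.
Proof. by rewrite rmorphN rmorphD !rmorphXn opprD. Qed.

Lemma newton_rmorph (R S : comNzRingType) (f : {rmorphism R -> S}) c u :
  newton c u -> newton (f \o c) (f \o u).
Proof.
move=> [u0 uS]; split=> [|n] /=; first by rewrite u0 rmorph1.
rewrite -(rmorph_nat f) -rmorphM uS rmorph_sum.
by apply: eq_bigr => i _; rewrite rmorphM.
Qed.

Lemma mul_linear_factors (R : comNzRingType) (z zi a b c : R) : z * zi = 1 ->
  a - z * b - zi * (b - z * c) = a - (z + zi) * b + c.
Proof. by move=> zz; rewrite mulrBr mulrA [zi * z]mulrC zz; ring. Qed.

(** * The kets as symplectic Jacobi-Trudi determinants *)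

Section Kets.
Variable F : fieldType.
Hypothesis charF0 : [pchar F] =i pred0.
Local Notation fock := {malg F[{cmonom nat}]}.
Local Notation Ann := (opsexp (@annihilation_series F)).
Local Notation h := (zext (@hfock F)).

(** The creation factor [H] is left free in order to treat Y, with h_n, and U, with h_n + h_{n-1},
    together. *)
Definition vertex_mode (H : int -> fock) (l : int) (v : fock) : fock :=
  \sum_(k \in [set: int]) H (l - k) * Ann k v.

Lemma vertex_modeE (H : int -> fock) (l : int) (w M : nat) (v : fock) :
  wt_le w%:Z v -> (w <= M)%N ->
  vertex_mode H l v =
  \sum_(i < M.*2.+1) H (l - (i%:Z - M%:Z)) * Ann (i%:Z - M%:Z) v.
Proof.
move=> Hw wM; apply: (fsum_int_shift (f := fun k => H (l - k) * Ann k v)) => k Mk.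
by rewrite (opsexp_annihilation0 charF0 Hw) ?mulr0 // (leq_ltn_trans wM).
Qed.

(** Multiplying by the series of H and extracting z^l replaces z^j by H(l - j) and z^-j by H(l + j),
    so a Laurent row becomes a Jacobi-Trudi row. *)
Lemma vertex_mode_laurent N (K : nat -> fock) (v : fock) (H : int -> fock) (l : int) :
  (forall z : F, z != 0 -> translate (annihilation_psum z) v =
    \sum_(j < N) laurent_entry z%:A z^-1%:A j * K j) ->
  vertex_mode H l v = \sum_(j < N) sp_entry H j l * K j.
Proof.
move=> vK; have [w Hw] := wt_le_ex v; pose M := (w + N)%N.
have AnnE (i : nat) : (i < M.*2.+1)%N ->
    Ann (i%:Z - M%:Z) v = laurent_coef N K (i%:Z - M%:Z).
  apply: (fock_coef_uniq charF0 (a := fun i => Ann (i%:Z - M%:Z) v)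
    (b := fun i => laurent_coef N K (i%:Z - M%:Z))) => z z0.
  (* The factor z^M clears the negative powers, since M bounds both the weight of v and the degree
     N. *)
  have zE (n : nat) : z ^+ n = z ^+ M * z ^ (n%:Z - M%:Z).
    by rewrite [z ^+ M]exprnP -expfzDr // addrC subrK.
  transitivity (z ^+ M *: translate (annihilation_psum z) v).
    rewrite -(translate_annihilation charF0 z0) (fsum_int_shift (M := M)); last first.
      move=> k Mk; rewrite (opsexp_annihilation0 charF0 Hw) ?scaler0 //.
      by apply: leq_ltn_trans Mk; exact: leq_addr.
    by rewrite scaler_sumr; apply: eq_bigr => k _; rewrite scalerA -zE.
  have entryE (j : nat) : laurent_entry z%:A z^-1%:A j =
      (z ^ j%:Z)%:A + (if j is 0 then 0 else (z ^ (- j%:Z))%:A) :> fock.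
    exact: (laurent_entry_rmorph (in_alg fock)).
  rewrite vK //; under eq_bigr do rewrite entryE.
  rewrite -(sum_laurent_coef K (fun k => (z ^ k)%:A) (leq_addl w N)) scaler_sumr.
  by apply: eq_bigr => k _; rewrite mulr_algl scalerA -zE.
rewrite (vertex_modeE _ _ Hw (leq_addr N w)) -/M.
transitivity (\sum_(i < M.*2.+1)
    H (l - (i%:Z - M%:Z)) * laurent_coef N K (i%:Z - M%:Z)).
  by apply: eq_bigr => i _; rewrite AnnE.
rewrite (sum_laurent_coef K (fun k => H (l - k)) (leq_addl w N)).
apply: eq_bigr => -[j /= j_lt] _; congr (_ * _); rewrite /sp_entry.
case: j j_lt => [|j] _; first by rewrite subr0 !addr0.
by rewrite addrC opprK.
Qed.

Lemma malgCE (c : F) : c%:MP = c%:A :> fock.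
Proof. by rewrite -[LHS]mulr1 mul_malgC. Qed.

Lemma newton_translate_hfock c :
  newton (fun i => fockX F i + (c i)%:A) (translate c \o @hfock F).
Proof.
apply: eq_newton (newton_rmorph (translate c) (newton_hfock charF0)) => i //=.
by rewrite translateX malgCE.
Qed.

(** Subtracting z^n + z^-n from the power sums multiplies the generating series by (1 - zt)(1 - z^-1
    t), by uniqueness in Newton's identities. *)
Lemma translate_hfock (z : F) (n : int) : z != 0 ->
  translate (annihilation_psum z) (h n) =
  h n - (z%:A + z^-1%:A) * h (n - 1) + h (n - 2).
Proof.
move=> z0.
have zz : z%:A * z^-1%:A = 1 :> fock.
  by rewrite mulr_algl scalerA mulfV // scale1r.
have hE : translate (annihilation_psum z) \o @hfock F =1
    twist z^-1%:A (twist z%:A (@hfock F)).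
  apply: newton_uniq (fock_natI charF0) (newton_translate_hfock _) _.
  apply: eq_newton (newton_twist z^-1%:A
    (newton_twist z%:A (newton_hfock charF0))) => // i.
  rewrite -addrA; congr (_ + _); apply/esym.
  exact: (annihilation_psum_rmorph (in_alg fock)).
have -> : translate (annihilation_psum z) (h n) =
    zext (twist z^-1%:A (twist z%:A (@hfock F))) n.
  by case: n => n; [exact: hE | exact: rmorph0].
rewrite !zext_twist (_ : n - 1 - 1 = n - 2); last by lia.
exact: mul_linear_factors.
Qed.

Lemma rmorph_sp_entry (R S : comNzRingType) (f : {rmorphism R -> S}) H j s :
  f (sp_entry H j s) = sp_entry (f \o H) j s.
Proof. rewrite /sp_entry rmorphD; case: j => [|j] //=; congr (_ + _); exact: rmorph0. Qed.

(** Induction on the parts: translating the determinant for the tail produces, by [det_sp_step] read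
    backwards, a larger one with a Laurent top row, which the vertex mode turns into the row of the
    new part. *)
Lemma foldr_vertex_mode (H : int -> fock) (lam : seq nat) :
  (forall z n, z != 0 -> translate (annihilation_psum z) (H n) =
     H n - (z%:A + z^-1%:A) * H (n - 1) + H (n - 2)) ->
  foldr (fun l : nat => vertex_mode H l%:Z) 1 lam =
  \det (\matrix_(i < size lam, j < size lam)
    sp_entry H j ((nth 0%N lam i)%:Z - i%:Z)).
Proof.
move=> HE; elim: lam => [|l lam IH]; first by rewrite det_mx00.
rewrite [foldr _ _ _]/= IH; set n := size lam.
(* The old rows move down by one, so their arguments drop by 1; [det_sp_step] restores the old ones
   as [s i + 1]. *)
pose s i := (nth 0%N lam i)%:Z - i.+1%:Z.
pose K j := cofactor (\matrix_(i < n.+1, j < n.+1) sp_rows (fun=> 0) H s i j)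
  ord0 (inord j).
have KE top : \det (\matrix_(i < n.+1, j < n.+1) sp_rows top H s i j) =
    \sum_(j < n.+1) top j * K j.
  by rewrite det_sp_rows; apply: eq_bigr => j _; rewrite /K inord_val.
rewrite (vertex_mode_laurent (N := n.+1) (K := K)) => [|z z0].
  rewrite -(KE (fun j => sp_entry H j l)); congr (\det _).
  by apply/matrixP => -[[|i] i_lt] j; rewrite !mxE /= ?subr0.
rewrite -KE det_sp_step; last by rewrite mulr_algl scalerA mulfV // scale1r.
rewrite -det_map_mx; congr (\det _); apply/matrixP => i j; rewrite !mxE.
rewrite [LHS]rmorph_sp_entry (_ : s i + 1 = (nth 0%N lam i)%:Z - i%:Z).
  by rewrite /sp_entry /=; case: (j : nat) => [|k]; rewrite !HE.
by rewrite /s; lia.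
Qed.

End Kets.

(** * From symplectic to odd and even orthogonal determinants *)

Section JacobiTrudiDeterminants.
Variables (R : comNzRingType) (n : nat) (H : int -> R) (s : nat -> int).

(** Column j on the left is the sum of the columns j and j - 1 on the right. *)
Lemma det_sp_entry_so :
  \det (\matrix_(i < n, j < n) sp_entry (fun k => H k + H (k - 1)) j (s i)) =
  \det (\matrix_(i < n, j < n) (H (s i + j%:Z) + H (s i - j%:Z - 1))).
Proof.
rewrite -(det_column_operation _ (fun i j => H (s i + j%:Z) + H (s i - j%:Z - 1))
  (fun k j => if k.+1 == j then 1 else 0)).
congr (\det _); apply/matrixP => i j; rewrite !mxE /sp_entry.
case: (j : nat) => [|k]; first by rewrite big_ord0 subr0.
rewrite (sum_last1 (fun k => H (s i + k%:Z) + H (s i - k%:Z - 1))) mulr1.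
rewrite (_ : s i + k.+1%:Z - 1 = s i + k%:Z); last by lia.
rewrite (_ : s i - k%:Z - 1 = s i - k.+1%:Z); last by lia.
by ring.
Qed.

(** Column j on the left is column j minus column j - 2 on the right; columns 0 and 1 already
    agree. *)
Lemma det_sp_entry_o :
  \det (\matrix_(i < n, j < n) sp_entry (fun k => H k - H (k - 2)) j (s i)) =
  \det (\matrix_(i < n, j < n) (H (s i + j%:Z) - H (s i - j%:Z - 2))).
Proof.
rewrite -(det_column_operation _ (fun i j => H (s i + j%:Z) - H (s i - j%:Z - 2))
  (fun k j => if k.+1 == j then 0 else if k.+2 == j then -1 else 0)).
congr (\det _); apply/matrixP => i j; rewrite !mxE /sp_entry.
case: (j : nat) => [|[|k]]; first by rewrite big_ord0 subr0.
  rewrite (sum_last1 (fun k => H (s i + k%:Z) - H (s i - k%:Z - 2))) mulr0.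
  by rewrite (_ : s i + 1%:Z - 2 = s i - 1%:Z); [ring | lia].
rewrite (sum_last2 (fun k => H (s i + k%:Z) - H (s i - k%:Z - 2))) mulr0.
rewrite (_ : s i + k.+2%:Z - 2 = s i + k%:Z); last by lia.
rewrite (_ : s i - k%:Z - 2 = s i - k.+2%:Z); last by lia.
by ring.
Qed.

End JacobiTrudiDeterminants.

(** * Vacuum expectations and half vertex operators as evaluations *)

Section Evaluation.
Variable F : fieldType.
Hypothesis charF0 : [pchar F] =i pred0.
Local Notation fock := {malg F[{cmonom nat}]}.
Local Notation h := (zext (@hfock F)).

Lemma YseriesE (l : int) (v : fock) : Yseries l v = vertex_mode h l v.
Proof. by apply: eq_fsbigr => k _; rewrite creation_modeE. Qed.

Lemma UseriesE (l : int) (v : fock) :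
  Useries l v = vertex_mode (fun k => h k + h (k - 1)) l v.
Proof.
rewrite /Useries !YseriesE; have [w Hw] := wt_le_ex v.
rewrite !(vertex_modeE charF0 _ _ Hw (leqnn w)) -big_split.
by apply: eq_bigr => i _; rewrite mulrDl addrAC.
Qed.

(** The constant term after translation is the value at a_{-(i+1)} = c_i, so this is h_n with
    prescribed power sums. *)
Definition hspec (c : nat -> F) (n : nat) : F := vacdual (translate c (hfock F n)).

Lemma newton_hspec c : newton c (hspec c).
Proof.
apply: eq_newton (newton_rmorph (@mcoeff {cmonom nat} F mone)
  (newton_translate_hfock charF0 c)) => i //=.
rewrite [LHS]mcoeffD [X in _ + X]mcoeffZ [X in _ * X]mcoeff1 eqxx mulr1.
by rewrite [X in X + _]mcoeffU1 cm1_eq1 add0r.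
Qed.

Lemma vacdual_translate_det c (H : int -> fock) n (s : nat -> int) :
  vacdual (translate c (\det (\matrix_(i < n, j < n) sp_entry H j (s i)))) =
  \det (\matrix_(i < n, j < n)
    sp_entry (fun k => vacdual (translate c (H k))) j (s i)).
Proof.
rewrite /vacdual -!det_map_mx; congr (\det _); apply/matrixP => i j.
rewrite !mxE; apply: etrans (congr1 _ (rmorph_sp_entry (translate c) _ _ _)) _.
exact: (rmorph_sp_entry (@mcoeff {cmonom nat} F mone)).
Qed.

Lemma vacdual_translate_h c (k : int) :
  vacdual (translate c (h k)) = zext (hspec c) k.
Proof.
by case: k => k //; rewrite /vacdual [translate c _]rmorph0 mcoeff0.
Qed.

Lemma vacdual_translate_ket_sp c n (lam : seq nat) : size lam = n ->
  vacdual (translate c (ket_sp F lam)) =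
  \det (\matrix_(i < n, j < n)
    sp_entry (zext (hspec c)) j ((nth 0%N lam i)%:Z - i%:Z)).
Proof.
move=> <-; have -> : ket_sp F lam = foldr (fun l : nat => vertex_mode h l%:Z) 1 lam.
  by rewrite /ket_sp; elim: lam => [|l lam IH] //=; rewrite IH /Ymode opprK YseriesE.
rewrite foldr_vertex_mode //; last by move=> z k; exact: translate_hfock.
rewrite (vacdual_translate_det c h _ (fun i => (nth 0%N lam i)%:Z - i%:Z)).
congr (\det _); apply/matrixP => i j; rewrite !mxE.
by congr (sp_entry _ _ _); apply/funext => k; exact: vacdual_translate_h.
Qed.

Lemma translate_hfock_add (z : F) (k : int) : z != 0 ->
  translate (annihilation_psum z) (h k + h (k - 1)) =
  h k + h (k - 1) - (z%:A + z^-1%:A) * (h (k - 1) + h (k - 1 - 1)) +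
  (h (k - 2) + h (k - 2 - 1)).
Proof.
move=> z0; rewrite rmorphD /= !translate_hfock //.
rewrite (_ : k - 1 - 2 = k - 2 - 1); last by lia.
rewrite (_ : k - 2 = k - 1 - 1); last by lia.
have abs (S : comNzRingType) (x y p q r : S) :
  x - r * y + p + (y - r * p + q) = x + y - r * (y + p) + (p + q) by ring.
exact: abs.
Qed.

Lemma vacdual_translate_ket_so c n (lam : seq nat) : size lam = n ->
  vacdual (translate c (ket_so F lam)) =
  \det (\matrix_(i < n, j < n)
    sp_entry (fun k => zext (hspec c) k + zext (hspec c) (k - 1)) j
      ((nth 0%N lam i)%:Z - i%:Z)).
Proof.
move=> <-; have -> : ket_so F lam =
    foldr (fun l : nat => vertex_mode (fun k => h k + h (k - 1)) l%:Z) 1 lam.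
  by rewrite /ket_so; elim: lam => [|l lam IH] //=; rewrite IH /Umode opprK UseriesE.
rewrite foldr_vertex_mode //; last by move=> z k; exact: translate_hfock_add.
rewrite (vacdual_translate_det c _ _ (fun i => (nth 0%N lam i)%:Z - i%:Z)).
congr (\det _); apply/matrixP => i j; rewrite !mxE.
congr (sp_entry _ _ _); apply/funext => k.
by rewrite rmorphD -!vacdual_translate_h /vacdual mcoeffD.
Qed.

Lemma GammaE (z : F) : Gamma z =1 translate (fun i => z ^+ i.+1).
Proof.
have deltaG : (fun u : fock => \sum_(n \in [set: nat])
    (z ^+ n.+1 / n.+1%:R) *: heis n.+1%:Z u) = delta (fun i => z ^+ i.+1).
  apply/funext => u; apply: eq_fsbigr => i _ /=.
  by rewrite scalerA divfK // natF_neq0.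
by rewrite /Gamma deltaG; exact: opexp_delta.
Qed.

(** Translations by opposite sequences are mutually inverse, so the partial inverse is a true
    two-sided inverse. *)
Lemma Gamma_invE (z : F) : Gamma_inv z =1 translate (fun i => - z ^+ i.+1).
Proof.
have GK v : translate (fun i => - z ^+ i.+1) (Gamma z v) = v.
  rewrite GammaE translateD (eq_translate (d := fun=> 0)) ?translate0 // => i.
  by rewrite addNr.
have KG v : Gamma z (translate (fun i => - z ^+ i.+1) v) = v.
  rewrite GammaE translateD (eq_translate (d := fun=> 0)) ?translate0 // => i.
  by rewrite addrN.
have inj : {in [set: fock]%classic &, injective (Gamma z)}.
  by move=> u u' _ _ uu'; rewrite -[u]GK uu' GK.
move=> v; rewrite -[v in LHS]KG.
by rewrite /Gamma_inv pinvKV ?in_setT.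
Qed.

Lemma Gamma_pmE N (x : 'I_N -> F) : Gamma_pm x =1 translate (psum x).
Proof.
rewrite /Gamma_pm; elim: N x => [|N IH] x v.
  rewrite big_ord0 -[LHS]translate0; apply: eq_translate => i.
  by rewrite /psum big_ord0.
rewrite big_ord_recl /= IH !GammaE !translateD; apply: eq_translate => i.
by rewrite /psum [RHS]big_ord_recl /= ?addrA.
Qed.

(** Index i stands for a_{i+1}, so even modes sit at odd i; a_{2n}/n acts as twice the derivative in
    a_{-2n}, hence the factor 2. *)
Definition even_psum (z : F) (i : nat) : F :=
  if odd i then - (2 * z ^+ i.+1./2) else 0.

Lemma sum_ord_double (V : zmodType) (f : nat -> V) n :
  \sum_(i < n.*2) f i = \sum_(i < n) (f i.*2 + f i.*2.+1).
Proof.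
by elim: n => [|n IH]; rewrite ?big_ord0 // doubleS !big_ord_recr /= IH addrA.
Qed.

Lemma Gamma_tildeE (z : F) : Gamma_tilde z =1 translate (even_psum z).
Proof.
suff deltaG : (fun u : fock => - \sum_(n \in [set: nat])
    (z ^+ n.+1 / n.+1%:R) *: heis (2 * n.+1)%N%:Z u) = delta (even_psum z).
  by rewrite /Gamma_tilde deltaG; exact: opexp_delta.
apply/funext => u; have [w Hw] := wt_le_ex u.
have heisE n : heis (2 * n.+1)%N%:Z u = n.*2.+2%:R *: fockD n.*2.+1 u.
  by rewrite mul2n doubleS.
rewrite (fsum_nat (M := w)) => [|n wn]; last first.
  by rewrite heisE (fockD_wt0 Hw) ?scaler0 //; lia.
have ww : (w <= w.*2)%N by lia.
rewrite (deltaE _ Hw ww) (sum_ord_double (fun i => even_psum z i *: fockD i u)).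
rewrite -sumrN; apply: eq_bigr => n _.
rewrite heisE /even_psum /= odd_double /= scale0r add0r doubleK scalerA scaleNr.
suff -> : z ^+ n.+1 / n.+1%:R * n.*2.+2%:R = 2 * z ^+ n.+1 by [].
by rewrite -doubleS -mul2n natrM mulrCA divfK // natF_neq0.
Qed.

End Evaluation.

(** * Specialisation to the classical characters *)

Section Characters.
Variable F : fieldType.
Hypothesis charF0 : [pchar F] =i pred0.
Variables (N : nat) (x : 'I_N -> F) (lam : N.-tuple nat).

Lemma field_natI n (a : F) : a *+ n.+1 = 0 -> a = 0.
Proof.
by move/eqP; rewrite -mulr_natr mulf_eq0 (negPf (natF_neq0 charF0 n)) orbF => /eqP.
Qed.

Lemma hspec_uniq c (u : nat -> F) : newton c u -> zext (hspec c) = zext u.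
Proof.
move=> cu; congr zext; apply/funext.
exact: newton_uniq field_natI (newton_hspec charF0 c) cu.
Qed.

Lemma zext_hseries : zext (hseries x) = h x.
Proof. by []. Qed.

Lemma so_charE : so_char x lam =
  \det (\matrix_(i < N, j < N)
    (h x ((nth 0%N lam i)%:Z - i%:Z + j%:Z) +
     h x ((nth 0%N lam i)%:Z - i%:Z - j%:Z - 1))).
Proof.
congr (\det _); apply/matrixP => i j; rewrite !mxE (tnth_nth 0%N).
by congr (h x _ + h x _); lia.
Qed.

Lemma o_charE : o_char x lam =
  \det (\matrix_(i < N, j < N)
    (h x ((nth 0%N lam i)%:Z - i%:Z + j%:Z) -
     h x ((nth 0%N lam i)%:Z - i%:Z - j%:Z - 2))).
Proof.
congr (\det _); apply/matrixP => i j; rewrite !mxE (tnth_nth 0%N).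
by congr (h x _ - h x _); lia.
Qed.

Lemma sp_charE : sp_char x lam =
  \det (\matrix_(i < N, j < N) sp_entry (h x) j ((nth 0%N lam i)%:Z - i%:Z)).
Proof.
congr (\det _); apply/matrixP => i j; rewrite !mxE (tnth_nth 0%N) /sp_entry.
congr (h x _ + _); first by lia.
case: (j : nat) => [|k]; first by rewrite mul0r.
by rewrite mul1r; congr (h x _); lia.
Qed.

Lemma ket_so_charE c u : newton c u -> zext u = h x ->
  vacdual (translate c (ket_so F lam)) = so_char x lam.
Proof.
move=> cu ux; rewrite (vacdual_translate_ket_so charF0 _ (size_tuple lam))
  (hspec_uniq cu) ux so_charE.
exact: (det_sp_entry_so _ (h x) (fun i => (nth 0%N lam i)%:Z - i%:Z)).
Qed.

(** The ket contributes u_k + u_{k-1}, which telescopes to h_k - h_{k-2}, the input of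
    [det_sp_entry_o]. *)
Lemma ket_so_o_charE c u : newton c u -> (forall k, zext u k = h x k - h x (k - 1)) ->
  vacdual (translate c (ket_so F lam)) = o_char x lam.
Proof.
move=> cu ux; rewrite (vacdual_translate_ket_so charF0 _ (size_tuple lam))
  (hspec_uniq cu) o_charE.
rewrite -(det_sp_entry_o _ (h x) (fun i => (nth 0%N lam i)%:Z - i%:Z)).
congr (\det _); apply/matrixP => i j; rewrite !mxE.
congr (sp_entry _ _ _); apply/funext => k; rewrite !ux addrA subrK.
by rewrite (_ : k - 1 - 1 = k - 2) //; lia.
Qed.

Lemma ket_so_sp_charE c u : newton c u -> (forall k, zext u k + zext u (k - 1) = h x k) ->
  vacdual (translate c (ket_so F lam)) = sp_char x lam.
Proof.
move=> cu ux; rewrite (vacdual_translate_ket_so charF0 _ (size_tuple lam))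
  (hspec_uniq cu) sp_charE.
congr (\det _); apply/matrixP => i j; rewrite !mxE.
by congr (sp_entry _ _ _); apply/funext => k; rewrite ux.
Qed.

Lemma ket_sp_charE c u : newton c u -> zext u = h x ->
  vacdual (translate c (ket_sp F lam)) = sp_char x lam.
Proof.
by move=> cu ux; rewrite (vacdual_translate_ket_sp charF0 _ (size_tuple lam))
  (hspec_uniq cu) ux sp_charE.
Qed.

Lemma ket_sp_o_charE c u : newton c u -> (forall k, zext u k = h x k - h x (k - 2)) ->
  vacdual (translate c (ket_sp F lam)) = o_char x lam.
Proof.
move=> cu ux; rewrite (vacdual_translate_ket_sp charF0 _ (size_tuple lam))
  (hspec_uniq cu) o_charE.
rewrite -(det_sp_entry_o _ (h x) (fun i => (nth 0%N lam i)%:Z - i%:Z)).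
congr (\det _); apply/matrixP => i j; rewrite !mxE.
by congr (sp_entry _ _ _); apply/funext => k; rewrite ux.
Qed.

Lemma sBDE alpha : sBD x lam alpha =
  vacdual (translate (fun i => psum x i - alpha ^+ i.+1) (ket_so F lam)).
Proof. by rewrite /sBD (Gamma_pmE charF0) (Gamma_invE charF0) translateD. Qed.

Lemma sBCE alpha : sBC x lam alpha =
  vacdual (translate (fun i => psum x i + alpha ^+ i.+1) (ket_so F lam)).
Proof. by rewrite /sBC (Gamma_pmE charF0) (GammaE charF0) translateD. Qed.

Lemma sCDE alpha : sCD x lam alpha =
  vacdual (translate (fun i => psum x i + even_psum alpha i) (ket_sp F lam)).
Proof. by rewrite /sCD (Gamma_pmE charF0) (Gamma_tildeE charF0) translateD. Qed.

Lemma newton_psum_shift c : c =1 psum x -> newton c (hseries x).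
Proof. by move=> cx; apply: eq_newton (newton_hseries x) => // i. Qed.

End Characters.

Theorem mainTheorem8 (F : fieldType) (charF0 : [pchar F] =i pred0)
    (N : nat) (N_ge1 : (1 <= N)%N)
    (lam : N.-tuple nat) (lam_partition : sorted geq lam)
    (x : 'I_N -> F) (x_neq0 : forall i, x i != 0) :
  [/\ sBD x lam 0 = so_char x lam,
      sBD x lam 1 = o_char x lam &
      sBC x lam 0 = so_char x lam] /\
  [/\ sBC x lam (-1) = sp_char x lam,
      sCD x lam 0 = sp_char x lam &
      sCD x lam 1 = o_char x lam].
Proof.
have zext_twist1 u (k : int) : zext (twist (1 : F) u) k = zext u k - zext u (k - 1).
  by rewrite zext_twist mul1r.
have zext_twistN1 u (k : int) : zext (twist (-1 : F) u) k = zext u k + zext u (k - 1).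
  by rewrite zext_twist mulN1r opprK.
rewrite !(sBDE charF0) !(sBCE charF0) !(sCDE charF0); split; split.
- apply: (@ket_so_charE _ charF0 _ x _ _ (hseries x)) => //.
  by apply: newton_psum_shift => i; rewrite expr0n subr0.
(* Applying the inverse of Gamma_+(1) multiplies the generating series by 1 - z. *)
- apply: (ket_so_o_charE charF0 lam (newton_twist 1 (newton_hseries x))) => k.
  by rewrite zext_twist1.
- apply: (@ket_so_charE _ charF0 _ x _ _ (hseries x)) => //.
  by apply: newton_psum_shift => i; rewrite expr0n addr0.
- (* multiplying by Gamma_+(-1) divides the generating series by 1 + z *)
  pose c i := psum x i + (-1) ^+ i.+1.
  apply: (ket_so_sp_charE charF0 lam (newton_hspec charF0 c)) => k.
  rewrite -zext_twistN1; congr (zext _ k); apply/funext.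
  apply: (newton_uniq (field_natI charF0) _ (newton_hseries x)).
  apply: eq_newton (newton_twist (-1) (newton_hspec charF0 c)) => // i.
  by rewrite /c addrK.
- apply: (@ket_sp_charE _ charF0 _ x _ _ (hseries x)) => //.
  apply: newton_psum_shift => i; rewrite /even_psum.
  case: i => [|i] /=; first by rewrite addr0.
  by rewrite exprS mul0r mulr0 oppr0 if_same addr0.
- (* (1 - z)(1 + z) = 1 - z^2 *)
  have nwt := newton_twist (-1) (newton_twist 1 (newton_hseries x)).
  apply: (@ket_sp_o_charE _ charF0 _ x _ _ (twist (-1) (twist 1 (hseries x)))).
    (* The two factors contribute -1 - (-1)^{i+1}, which is -2 at odd i and 0 at even i. *)
    apply: eq_newton nwt => // i; rewrite /even_psum expr1n -addrA; congr (_ + _).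
    rewrite expr1n mulr1 -signr_odd /=.
    by case: (odd i); rewrite /= ?expr0 ?expr1; ring.
  move=> k; rewrite zext_twistN1 !zext_twist1 zext_hseries addrA subrK.
  by rewrite (_ : k - 1 - 1 = k - 2) //; lia.
Qed.
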